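(* Let $0<\alpha<2$, $H\in(0,1)$, and let $X=\{X(t),t\in\mathbb{R}^N\}$ be the real-valued harmonizable-type $\alpha$-stable random field $$X(t)=\mathrm{Re}\int_{\mathbb{R}^N}\big(e^{i\langle t,x\rangle}-1\big)\,\widetilde M_\alpha(dx),$$ where $\widetilde M_\alpha$ is a rotationally invariant $\alpha$-stable random measure on $\mathbb{R}^N$ whose control measure $\Delta$ satisfies $\int_{\mathbb{R}^N}(1\wedge|x|^\alpha)\,\Delta(dx)<\infty$ and is absolutely continuous with density $f$ (the spectral density of $X$) such that, for some constants $K_{11},K_{12}>0$, $$f(x)\le K_{11}\,|x|^{-(\alpha H+N)}\qquad\text{for all }x\in\mathbb{R}^N\text{ with }|x|\ge K_{12}.$$ Then (for a version of $X$ with continuous sample paths, which exists) for any $\varepsilon>0$ $$\limsup_{h\to0+}\frac{\sup_{s,t\in[0,1]^N,\ |s-t|\le h}|X(t)-X(s)|}{h^H\,\big(\log(1/h)\big)^{(2+\varepsilon)/\alpha}}=0\qquad\text{almost surely.}$$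
   Context: $|\cdot|$ and $\langle\cdot,\cdot\rangle$ are the Euclidean norm and inner product on $\mathbb{R}^N$. The finite-dimensional distributions of $X$ are symmetric $\alpha$-stable, determined by: for all $t^1,\dots,t^m\in\mathbb{R}^N$ and $a_1,\dots,a_m\in\mathbb{R}$, $$\mathbb{E}\exp\Big(i\sum_{k=1}^m a_kX(t^k)\Big)=\exp\Big(-\int_{\mathbb{R}^N}\Big|\sum_{k=1}^m a_k\big(e^{i\langle t^k,x\rangle}-1\big)\Big|^\alpha f(x)\,dx\Big).$$ A version of $X$ is a random field $\widetilde X$ on the same probability space with $\mathbb{P}(\widetilde X(t)=X(t))=1$ for every $t$. *)

(* Defs.v *)
From HB Require Import structures.
From mathcomp Require Import all_boot all_order all_algebra.
From mathcomp Require Import complex.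
From mathcomp Require Import all_classical all_reals all_analysis.

Set Implicit Arguments.
Unset Strict Implicit.
Unset Printing Implicit Defensive.
Import Order.TTheory GRing.Theory Num.Theory.
Import numFieldNormedType.Exports.
Local Open Scope classical_set_scope.
Local Open Scope ring_scope.

(* Points of R^N are row vectors ['rV[R]_N], with the library's (product) *)
(* topology.  Note that the library's norm on matrices is the max norm, hence *)
(* the separate Euclidean norm below. *)

Section euclidean.
Context {R : rcfType} {N : nat}.
Implicit Types x y : 'rV[R]_N.

Definition inner x y : R := \sum_(i < N) x ord0 i * y ord0 i.

Definition enorm x : R := Num.sqrt (inner x x).

End euclidean.

(* sigma-algebra on R^N generated by the coordinates, i.e. the product of the *)
(* Borel sigma-algebras, which is the Borel sigma-algebra of R^N. *)

Definition measure_row_display : measure_display -> measure_display.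
Proof. exact. Qed.

Section measurable_row.
Context {d} {T : measurableType d} (n : nat).

Let coor (i : 'I_n) (v : 'rV[T]_n) : T := v ord0 i.

Let row_set0 : g_sigma_preimage coor set0.
Proof. exact: sigma_algebra0. Qed.

Let row_setC A : g_sigma_preimage coor A -> g_sigma_preimage coor (~` A).
Proof. exact: sigma_algebraC. Qed.

Let row_bigcup (F : (set 'rV[T]_n)^nat) :
  (forall i, g_sigma_preimage coor (F i)) ->
  g_sigma_preimage coor (\bigcup_i (F i)).
Proof. exact: sigma_algebra_bigcup. Qed.

HB.instance Definition _ := @isMeasurable.Build (measure_row_display d)
  'rV[T]_n (g_sigma_preimage coor) row_set0 row_setC row_bigcup.

End measurable_row.

Lemma measurable_coord d (T : measurableType d) n (i : 'I_n) :
  measurable_fun [set: 'rV[T]_n] (fun v : 'rV[T]_n => v ord0 i).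
Proof.
move=> _ Y mY; rewrite setTI; apply: sub_sigma_algebra => /=.
rewrite -bigcup_seq/=; exists i => /=; first by rewrite mem_index_enum.
by exists Y => //; rewrite setTI.
Qed.

Lemma measurable_fun_row d1 d2 (T1 : measurableType d1) (T2 : measurableType d2)
    n (f : T1 -> 'rV[T2]_n) :
  (forall i, measurable_fun [set: T1] (fun x => f x ord0 i)) ->
  measurable_fun [set: T1] f.
Proof.
move=> mf; apply: (@measurability _ _ _ _ _ _
  (\big[setU/set0]_(i < n)
    preimage_set_system setT (fun v : 'rV[T2]_n => v ord0 i) measurable)) => //.
move=> _ [A + <-]; rewrite -bigcup_seq => -[i _ [B mB <-]].
by rewrite setTI; have := mf i measurableT B mB.
Qed.

Section lebesgue_row.
Context {R : realType}.

Definition row_cons n (p : R * 'rV[R]_n) : 'rV[R]_n.+1 :=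
  \row_i (if unlift ord0 i is Some j then p.2 ord0 j else p.1).

Definition row_uncons n (v : 'rV[R]_n.+1) : R * 'rV[R]_n :=
  (v ord0 ord0, \row_i v ord0 (lift ord0 i)).

Lemma row_cons0 n p : @row_cons n p ord0 ord0 = p.1.
Proof. by rewrite mxE unlift_none. Qed.

Lemma row_consS n p i : @row_cons n p ord0 (lift ord0 i) = p.2 ord0 i.
Proof. by rewrite mxE liftK. Qed.

Lemma row_consK n : cancel (@row_cons n) (@row_uncons n).
Proof.
move=> [x v]; rewrite /row_uncons row_cons0; congr pair.
by apply/rowP => i; rewrite mxE row_consS.
Qed.

Lemma measurable_row_cons n : measurable_fun setT (@row_cons n).
Proof.
apply: measurable_fun_row => i; case: (unliftP ord0 i) => [j|] ->.
  under eq_fun do rewrite row_consS.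
  exact: (measurableT_comp (measurable_coord j) measurable_snd).
under eq_fun do rewrite row_cons0.
exact: measurable_fst.
Qed.

Lemma measurable_row_uncons n : measurable_fun setT (@row_uncons n).
Proof.
apply: measurable_fun_pair; first exact: measurable_coord.
apply: measurable_fun_row => i /=.
by under eq_fun do rewrite mxE; exact: measurable_coord.
Qed.

(* The library's Lebesgue measure lives on [measurableTypeR R]; this is the *)
(* same set function, seen as a measure on [R] with its Borel display. *)
Definition lebesgue_line (A : set R) : \bar R := lebesgue_measure A.

Let line0 : lebesgue_line set0 = 0%E.
Proof. exact: measure0. Qed.

Let line_ge0 A : (0 <= lebesgue_line A)%E.
Proof. exact: (measure_ge0 (@lebesgue_measure R)). Qed.

Let line_sigma_additive : semi_sigma_additive lebesgue_line.
Proof. exact: (@measure_semi_sigma_additive _ _ _ (@lebesgue_measure R)). Qed.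

HB.instance Definition _ := isMeasure.Build _ _ _ lebesgue_line
  line0 line_ge0 line_sigma_additive.

Let line_sigma_finite : sigma_finite setT lebesgue_line.
Proof. exact: (sigma_finiteT (@lebesgue_measure R)). Qed.

HB.instance Definition _ := Measure_isSigmaFinite.Build _ _ _ lebesgue_line
  line_sigma_finite.

Section step.
Context (n : nat) (m : {sigma_finite_measure set 'rV[R]_n -> \bar R}).

Definition lebesgue_row_step : set 'rV[R]_n.+1 -> \bar R :=
  pushforward (lebesgue_line \x m)%E (@row_cons n).

Let measurable_preimage A : measurable A -> measurable (@row_cons n @^-1` A).
Proof.
by move=> mA; rewrite -[X in measurable X]setTI; exact: measurable_row_cons.
Qed.

Let step0 : lebesgue_row_step set0 = 0%E.
Proof. by rewrite /lebesgue_row_step /pushforward preimage_set0 measure0. Qed.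

Let step_ge0 A : (0 <= lebesgue_row_step A)%E.
Proof. exact: (measure_ge0 (lebesgue_line \x m)%E). Qed.

Let step_sigma_additive : semi_sigma_additive lebesgue_row_step.
Proof.
move=> F mF tF mUF; rewrite /lebesgue_row_step /pushforward preimage_bigcup.
apply: measure_semi_sigma_additive.
- by move=> k; exact: measurable_preimage.
- apply/trivIsetP => /= i j _ _ ij; rewrite -preimage_setI.
  by move/trivIsetP : tF => /(_ _ _ _ _ ij) ->//; rewrite preimage_set0.
- by rewrite -preimage_bigcup; exact: measurable_preimage.
Qed.

HB.instance Definition _ := isMeasure.Build _ _ _ lebesgue_row_step
  step0 step_ge0 step_sigma_additive.

Let step_sigma_finite : sigma_finite setT lebesgue_row_step.
Proof.
have /sigma_finiteP[F [TF ndF Foo]] := sigma_finiteT lebesgue_line.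
have /sigma_finiteP[G [TG ndG Goo]] := sigma_finiteT m.
exists (fun k => @row_uncons n @^-1` (F k `*` G k)).
  rewrite -preimage_bigcup -(preimage_setT (@row_uncons n)); congr preimage.
  rewrite -setXTT TF TG predeqE => -[x y]; split.
    move=> [/= [i _ Fix] [k _ Gky]]; exists (maxn i k) => //; split.
    - by move: x Fix; exact/subsetPset/ndF/leq_maxl.
    - by move: y Gky; exact/subsetPset/ndG/leq_maxr.
  by move=> [i _ []/= ? ?]; split; exists i.
move=> k; have [mF Fk] := Foo k; have [mG Gk] := Goo k; split.
  rewrite -[X in measurable X]setTI; apply: measurable_row_uncons => //.
  exact: measurableX.
rewrite /lebesgue_row_step /pushforward -comp_preimage.
rewrite (_ : @row_uncons n \o @row_cons n = id) ?preimage_id; last first.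
  by apply/funext => p /=; rewrite row_consK.
by rewrite product_measure1E// lte_mul_pinfty// ge0_fin_numE.
Qed.

HB.instance Definition _ := Measure_isSigmaFinite.Build _ _ _ lebesgue_row_step
  step_sigma_finite.

End step.

Fixpoint lebesgue_row n : {sigma_finite_measure set 'rV[R]_n -> \bar R} :=
  match n with
  | 0 => \d_(0 : 'rV[R]_0)
  | n'.+1 => lebesgue_row_step (lebesgue_row n')
  end.

End lebesgue_row.

Lemma lebesgue_row_box (R : realType) n (A : 'I_n -> set R) :
  (forall i, measurable (A i)) ->
  lebesgue_row n [set v : 'rV[R]_n | forall i, A i (v ord0 i)] =
  (\prod_(i < n) lebesgue_line (A i))%E.
Proof.
elim: n => [|n IH] in A *.
  move=> _; rewrite big_ord0 /= diracE mem_set//; by case.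
move=> mA; rewrite big_ord_recl -IH => [|i]; last exact: mA.
rewrite /= /lebesgue_row_step /pushforward -product_measure1E//; last first.
  rewrite (_ : [set _ | _] = \big[setI/setT]_(i < n)
      ((fun v : 'rV[R]_n => v ord0 i) @^-1` A (lift ord0 i))).
    apply: bigsetI_measurable => i _; rewrite -[X in measurable X]setTI.
    exact: measurable_coord.
  apply/seteqP; split => v; rewrite -bigcap_seq /=.
    by move=> vA i _; exact: vA.
  by move=> vA i; apply: vA; rewrite /= mem_index_enum.
congr product_measure1; apply/seteqP; split => -[x v] /=.
  move=> vA; split=> [|i]; first by have := vA ord0; rewrite row_cons0.
  by have := vA (lift ord0 i); rewrite row_consS.
move=> [Ax Av] i; case: (unliftP ord0 i) => [j|] ->.
  by rewrite row_consS; exact: Av.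
by rewrite row_cons0.
Qed.

Section complex_valued.
Context {R : realType}.
Local Open Scope complex_scope.

(* Measurability for the Borel sigma-algebra of C = R^2. *)
Definition cmeasurable d (T : measurableType d) (g : T -> R[i]) : Prop :=
  measurable_fun setT (fun x => complex.Re (g x)) /\
  measurable_fun setT (fun x => complex.Im (g x)).

Definition cexpi (u : R) : R[i] := cos u +i* sin u.

Definition cexpectation d (Omega : measurableType d) (P : probability Omega R)
    (Y : Omega -> R[i]) : R[i] :=
  fine 'E_P[fun w => complex.Re (Y w)] +i* fine 'E_P[fun w => complex.Im (Y w)].

End complex_valued.

Section stable_random_measure.
Context {R : realType} {d dT : measure_display}
  {Omega : measurableType d} {T : measurableType dT}.
Variables (P : probability Omega R) (alpha : R).
Variables (Delta : {measure set T -> \bar R}) (M : set T -> Omega -> R[i]).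
Local Open Scope complex_scope.

Definition finite_measure_set (A : set T) : Prop :=
  measurable A /\ (Delta A < +oo)%E.

(* [M A] is only meaningful for [A] measurable with [Delta A < +oo].  The *)
(* characteristic function of the complex variable [M A], at theta, is *)
(* E exp(i Re(conj(theta) M(A))) = exp(- Delta(A) |theta|^alpha); that it only *)
(* depends on |theta| is rotational invariance.  The normalization of Delta is *)
(* the one for which E exp(i Re int g dM) = exp(- int |g|^alpha dDelta). *)
Record rot_inv_stable_random_measure : Prop := {
  rsm_measurable : forall A, finite_measure_set A -> cmeasurable (M A) ;
  rsm_stable : forall A (theta : R[i]), finite_measure_set A ->
    cexpectation P (fun w => cexpi (complex.Re (theta^* * M A w))) =
    (expR (- (fine (Delta A) * Normc.normc theta `^ alpha)))%:C ;
  rsm_independently_scattered : forall n (A : 'I_n -> set T),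
    (forall j, finite_measure_set (A j)) -> trivIset setT A ->
    forall B : 'I_n -> set (R * R), (forall j, measurable (B j)) ->
    P (\bigcap_(j in [set: 'I_n])
        [set w | B j (complex.Re (M (A j) w), complex.Im (M (A j) w))]) =
    (\prod_(j < n)
        P [set w | B j (complex.Re (M (A j) w), complex.Im (M (A j) w))])%E ;
  rsm_sigma_additive : forall F : (set T)^nat,
    (forall n, measurable (F n)) -> trivIset setT F ->
    (Delta (\bigcup_n F n) < +oo)%E ->
    {ae P, forall w,
      Normc.normc (\sum_(k < n) M (F k) w - M (\bigcup_k F k) w)
        @[n --> \oo] --> 0}
}.

(* The simple function sum_j c_j 1_(A_j), with the A_j pairwise disjoint. *)
Record csimple := CSimple {
  cs_size : nat ;
  cs_coef : 'I_cs_size -> R[i] ;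
  cs_set : 'I_cs_size -> set T ;
  cs_finite : forall j, finite_measure_set (cs_set j) ;
  cs_disjoint : trivIset setT cs_set
}.

Definition csimple_fun (s : csimple) (x : T) : R[i] :=
  \sum_(j < cs_size s) cs_coef j * (\1_(cs_set j) x)%:C.

Definition csimple_integral (s : csimple) (w : Omega) : R[i] :=
  \sum_(j < cs_size s) cs_coef j * M (cs_set j) w.

(* [Y] is (a version of) int g dM: the limit in probability of the integrals *)
(* of simple functions that tend to g in L^alpha(Delta). *)
Definition is_stochastic_integral (g : T -> R[i]) (Y : Omega -> R[i]) : Prop :=
  [/\ cmeasurable g, cmeasurable Y &
    exists s : csimple^nat,
      (\int[Delta]_x (Normc.normc (csimple_fun (s n) x - g x) `^ alpha)%:E)%E
        @[n --> \oo] --> 0%E /\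
      forall e : R, 0 < e ->
        P [set w | e <= Normc.normc (csimple_integral (s n) w - Y w)]
          @[n --> \oo] --> 0%E].

End stable_random_measure.

Section random_field.
Context {R : realType} {d : measure_display} {Omega : measurableType d}.
Variables (P : probability Omega R) (N : nat).

Definition harmonizable_field (alpha : R)
    (Delta : {measure set 'rV[R]_N -> \bar R})
    (M : set 'rV[R]_N -> Omega -> R[i]) (X : 'rV[R]_N -> {RV P >-> R}) : Prop :=
  forall t, exists2 Y : Omega -> R[i],
    is_stochastic_integral P alpha Delta M (fun x => cexpi (inner t x) - 1) Y &
    forall w, X t w = complex.Re (Y w).

Definition version (X Xt : 'rV[R]_N -> {RV P >-> R}) : Prop :=
  forall t, P [set w | Xt t w = X t w] = 1%E.

Definition continuous_paths (X : 'rV[R]_N -> {RV P >-> R}) : Prop :=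
  forall w, continuous (fun t => X t w).

Definition unit_cube : set 'rV[R]_N :=
  [set t | forall i, 0 <= t ord0 i <= 1].

Definition modulus (x : 'rV[R]_N -> R) (h : R) : \bar R :=
  ereal_sup [set `|x st.2 - x st.1|%:E | st in
    [set st : 'rV[R]_N * 'rV[R]_N |
      [/\ unit_cube st.1, unit_cube st.2 & enorm (st.1 - st.2) <= h]]].

End random_field.

(* Main.v *)
Require Import Defs.
From HB Require Import structures.
From mathcomp Require Import all_boot all_order all_algebra.
From mathcomp Require Import complex.
From mathcomp Require Import zify ring lra.
From mathcomp Require Import all_classical all_reals all_analysis.
From mathcomp Require Import measurable_realfun.

Set Implicit Arguments.
Unset Strict Implicit.
Unset Printing Implicit Defensive.
Import Order.TTheory GRing.Theory Num.Theory.
Import numFieldNormedType.Exports.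
Local Open Scope classical_set_scope.
Local Open Scope ring_scope.

(** Let tau_n(t) be the lower-left dyadic approximation of t at scale 2^-n.
    For neighbours s, t of level n the kernel of X(t) - X(s) is dominated by
    phi_n(x) = 2 N min(1, |x| / 2^n), which does not depend on the edge (s, t),
    and summing over the shells 2^i <= |x| < 2^(i+1) gives
    int phi_n^alpha dDelta <= C 2^(-n alpha H).

    After normalization, X(t) - X(s) is approximated by sums of independent
    stable variables x_i = Re(c_i M(A_i)); write x = sin x + (x - sin x).
    Since the characteristic function of x_i is real, E sin x_i = 0, and
    E sin^2 x_i <= 2 E (1 - cos x_i) is at most twice the scale of x_i, so that
    sum_i sin x_i has a bounded exponential moment and a union bound over the
    exponentially many edges only costs a term linear in n.  The remainders
    sum_i |x_i - sin x_i| are bounded simultaneously for all edges in terms of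
    the |M(A_i)|; their (alpha/2)-th moment is controlled because
    r |-> r^(alpha/2) is subadditive.  Hence the increments of level n are
    O(2^(-nH) n^((1+delta) 2/alpha)) outside an event of probability
    O(n^-(1+delta)), and Borel-Cantelli and dyadic chaining conclude. *)

(** * Elementary inequalities *)

(** A union bound over single stable tails of order [r^(-alpha)] would pay the number of edges as a
    power of [2^n] and lose part of the exponent [H]. Hence the split: the sine parts have
    exponential tails and absorb the union bound, while the heavy-tailed parts are controlled by one
    event common to all edges. That event fails with probability [O(1/q)] and costs [q^(2/alpha)];
    the choice [q = (n+1)^(1+delta)], summable in [1/q], is the origin of the logarithmic exponent.
    As [2/alpha > 1], the term linear in [n] is absorbed. The moment order [alpha/2] is below
    [alpha], for finiteness, and below 1, for subadditivity. A second obstacle is that a stochastic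
    integral is only a limit in probability, and the simple functions for different [t] live on
    unrelated sets. For each finite graph these sets are cut into common atoms, where independence
    applies, and the approximation error tends to 0 with the graph fixed. Finally only values on
    dyadic grids, a countable set, are estimated almost surely; the estimates therefore pass to any
    version, and continuity carries them to all points. *)

Section elementary.
Context {R : realType}.
Implicit Types x y s r q p a : R.

(** From [expR (- (s / 2)) >= 1 - s / 2] one gets [expR s * (1 - s / 2)^2 <= 1]. The rest is
    polynomial: [(1 + s + 2 s^2) (1 - s / 2)^2 - 1 = s^2 / 4 * (1 - s) (5 - 2 s)]. *)
Lemma expR_le_quad s : `|s| <= 1 -> expR s <= 1 + s + 2 * s ^+ 2.
Proof.
rewrite ler_norml => /andP[s1 s2].
have h1 := expR_ge1Dx (- (s / 2)).
have e1 : expR s * expR (- (s / 2)) ^+ 2 = 1.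
  rewrite expr2 -!expRD (_ : s + _ = 0) ?expR0//; lra.
have e0 := expR_gt0 s.
have e2 := expR_gt0 (- (s / 2)).
set e := expR (- (s / 2)) in h1 e1 e2 *.
have h2 : expR s * (1 - s / 2) ^+ 2 <= 1.
  rewrite -[leRHS]e1 ler_pM2l// ler_pXn2r// ?nnegrE; lra.
have h3 : 0 < (1 - s / 2) ^+ 2 by rewrite exprn_gt0//; lra.
rewrite -(ler_pM2r h3); apply: le_trans h2 _.
rewrite -subr_ge0 (_ : _ - 1 = s ^+ 2 / 4 * ((1 - s) * (5 - 2 * s))); last by field.
by apply: mulr_ge0; [have := sqr_ge0 s; lra|apply: mulr_ge0; lra].
Qed.

Lemma MVT_norm (f df : R -> R) (C x : R) :
  (forall y, is_derive y 1 f (df y)) -> f 0 = 0 ->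
  (forall y, `|y| <= `|x| -> `|df y| <= C) -> `|f x| <= C * `|x|.
Proof.
move=> fd f0 dfC.
have fc : forall A : set R, {within A, continuous f}.
  move=> A; apply: continuous_subspaceT => y.
  have [fy _] := fd y.
  by apply: differentiable_continuous; apply/derivable1_diffP.
have [x0|x0] := leP 0 x.
  have [c] := @MVT_segment _ f df 0 x x0 (fun y _ => fd y) (fc _).
  rewrite f0 !subr0 in_itv/= => /andP[c0 cx] ->; rewrite normrM.
  by rewrite ler_wpM2r// dfC// !ger0_norm.
have [c] := @MVT_segment _ f df x 0 (ltW x0) (fun y _ => fd y) (fc _).
rewrite f0 !sub0r in_itv/= => /andP[c0 cx] /eqP;
  rewrite mulrN eqr_opp => /eqP ->; rewrite normrM.
by rewrite ler_wpM2r// dfC// !ler0_norm// ?lerN2//; exact: ltW.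
Qed.

Lemma normr_sin_le x : `|sin x| <= `|x|.
Proof.
rewrite -[leRHS]mul1r; apply: (@MVT_norm sin cos) => //.
- by rewrite sin0.
- by move=> y _; rewrite ler_norml cos_geN1 cos_le1.
Qed.

Lemma normr_1Bcos_le x : `|1 - cos x| <= `|x|.
Proof.
rewrite -[leRHS]mul1r; apply: (@MVT_norm (fun x => 1 - cos x) sin) => //.
- move=> y.
  have -> : sin y = 0 - - sin y by rewrite sub0r opprK.
  exact: is_deriveB.
- by rewrite cos0 subrr.
- by move=> y _; rewrite ler_norml sin_geN1 sin_le1.
Qed.

Lemma normr_subsin_le_sqr x : `|x - sin x| <= x ^+ 2.
Proof.
rewrite -real_normK ?num_real// expr2.
apply: (@MVT_norm (fun x => x - sin x) (fun x => 1 - cos x)).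
- by rewrite sin0 subrr.
- by move=> y; apply: le_trans; exact: normr_1Bcos_le.
Qed.

Lemma normr_subsin_le x : `|x - sin x| <= 2 * `|x|.
Proof.
rewrite (le_trans (ler_normB _ _))//; have := normr_sin_le x; lra.
Qed.

Lemma cosB1 x : 1 - cos x = 2 * sin (x / 2) ^+ 2.
Proof.
have {1}-> : x = (x / 2) *+ 2 by rewrite -mulr_natr mulfVK.
rewrite cos_mulr2n; have := cos2Dsin2 (x / 2); set c := cos _; set s := sin _; lra.
Qed.

Lemma sin_ge_half x : 0 <= x <= 1 -> x / 2 <= sin x.
Proof.
move=> /andP[x0 x1].
suff : `|x - sin x| <= 2^-1 * `|x|.
  by rewrite ler_norml (ger0_norm x0); lra.
apply: (@MVT_norm (fun x => x - sin x) (fun x => 1 - cos x)).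
- by rewrite sin0 subrr.
- move=> y; rewrite (ger0_norm x0) => yx.
  rewrite cosB1 ger0_norm; last by rewrite mulr_ge0// sqr_ge0.
  have h : sin (y / 2) ^+ 2 <= (2^-1) ^+ 2.
    rewrite -real_normK ?num_real// ler_pXn2r ?nnegrE//.
    apply: (le_trans (normr_sin_le _)); rewrite normrM (@ger0_norm _ 2^-1)//; lra.
  lra.
Qed.

Lemma cosB1_ge x : `|x| <= 2 -> x ^+ 2 / 8 <= 1 - cos x.
Proof.
move=> x2.
have h : forall y, 0 <= y -> y <= 2 -> y ^+ 2 / 8 <= 1 - cos y.
  move=> y y0 y2; rewrite cosB1.
  have s0 : y / 2 / 2 <= sin (y / 2) by apply: sin_ge_half; lra.
  have h2 : (y / 2 / 2) ^+ 2 <= sin (y / 2) ^+ 2.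
    by rewrite ler_pXn2r// ?nnegrE; lra.
  lra.
have [x0|x0] := leP 0 x.
  by apply: h => //; rewrite ger0_norm in x2.
by rewrite -cosN -sqrrN; apply: h; [lra|rewrite ltr0_norm in x2].
Qed.

Lemma expRB1_le x : 1 - expR (- x) <= x.
Proof. by have := expR_ge1Dx (- x); lra. Qed.

(* Quadratic near 0 and a [p]-th power at infinity: with [p = alpha / 2] its  *)
(* expectation at a stable variable is finite. *)
Definition qpow p y : R := if `|y| <= 1 then y ^+ 2 else `|y| `^ p.

Lemma qpow_ge0 p y : 0 <= qpow p y.
Proof. by rewrite /qpow; case: ifP => _; rewrite ?sqr_ge0 ?powR_ge0. Qed.

Lemma normr_subsin_qpow p q x r : 0 < p -> p <= 1 -> 1 <= q ->
  `|x| <= `|r| -> qpow p r <= q ->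
  `|x - sin x| <= 2 * (qpow p r * q `^ (p^-1 - 1)).
Proof.
move=> p0 p1 q1 xr.
have e0 : 0 <= p^-1 - 1 by rewrite subr_ge0 invf_ge1.
have q1' : 1 <= q `^ (p^-1 - 1) by rewrite -[leLHS](powRr0 q) ler_powR.
rewrite /qpow; case: ifPn => [r1 rq|].
  apply: (le_trans (normr_subsin_le_sqr _)).
  have h : x ^+ 2 <= r ^+ 2 by rewrite -real_normK ?num_real// -[leRHS]real_normK
    ?num_real// ler_pXn2r ?nnegrE.
  apply: (le_trans h); have : 0 <= r ^+ 2 by exact: sqr_ge0.
  nra.
rewrite -ltNge => r1 rq.
apply: (le_trans (normr_subsin_le _)); rewrite ler_pM2l//.
apply: (le_trans xr).
have rE : `|r| = `|r| `^ p * (`|r| `^ p) `^ (p^-1 - 1).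
  rewrite -powRrM -powRD; last by rewrite (gt_eqF (lt_trans ltr01 r1)) implybT.
  by rewrite mulrBr mulr1 mulfV ?gt_eqF// subrKC powRr1.
have r0 := powR_ge0 `|r| p.
rewrite [leLHS]rE ler_wpM2l// ge0_ler_powR// nnegrE//.
exact: le_trans rq.
Qed.

Lemma powR2_itv y : 1 <= y -> exists k : nat, 2 ^+ k <= y < 2 ^+ k.+1.
Proof.
move=> y1.
have [k yk] : exists k : nat, y < 2 ^+ k.
  exists (Num.bound y); apply: (@lt_trans _ _ (Num.bound y)%:R).
    by have := archi_boundP (le_trans ler01 y1).
  by rewrite -natrX ltr_nat ltn_expl.
have ex : exists k, y < 2 ^+ k by exists k.
have [[|m] ym mmin] := ex_minnP ex.
  by move: ym; rewrite expr0 ltNge y1.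
exists m; rewrite ym andbT leNgt; apply/negP => /mmin.
by rewrite ltnn.
Qed.

(** For [|y| > 1] choose [k] with [u = y / 2^k] of modulus in [[1, 2)]. Then [|u|^p <= |u| <= 2],
    whereas [1 - cos u >= u^2 / 8 >= 1 / 8]; hence the constant 16. *)
Lemma qpow_le p y : 0 < p -> p <= 1 -> exists k : nat,
  qpow p y <= 16 * ((2 ^+ k) `^ p * (1 - cos (y / 2 ^+ k))).
Proof.
move=> p0 p1; rewrite /qpow; case: ifPn => [y1|].
  exists 0%N; rewrite expr0 powR1 divr1 mul1r.
  have : y ^+ 2 / 8 <= 1 - cos y by apply: cosB1_ge; lra.
  have := sqr_ge0 y; lra.
rewrite -ltNge => y1; have [k /andP[ky yk]] := powR2_itv (ltW y1).
exists k.
have k0 : (0 : R) < 2 ^+ k by rewrite exprn_gt0.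
set u := y / 2 ^+ k.
have yu : `|y| = 2 ^+ k * `|u|.
  by rewrite normrM normfV (gtr0_norm k0) mulrC divfK// gt_eqF.
have u1 : 1 <= `|u| by rewrite -(ler_pM2l k0) -yu mulr1.
have u2 : `|u| <= 2 by rewrite -(ler_pM2l k0) -yu -exprSr ltW.
have h := cosB1_ge u2.
rewrite yu powRM// ?(ltW k0)//.
rewrite mulrCA ler_wpM2l ?powR_ge0//.
have h1 : `|u| `^ p <= `|u| by apply: ler1_powR.
have h2 : 1 <= u ^+ 2 by rewrite -real_normK ?num_real// expr_ge1.
lra.
Qed.

End elementary.

(** * Independence and product expectations *)

Section product_rule.
Context {R : realType} {d d' : measure_display}
  {Omega : measurableType d} {T : measurableType d'}.
Variable mu : {measure set Omega -> \bar R}.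
Local Open Scope ereal_scope.
Import HBNNSimple.

(** The passage from indicators to nonnegative functions of [Z], through simple functions and
    monotone convergence. It will free one factor of a product at a time. *)
Lemma ge0_integral_factor (Z : Omega -> T) (h : Omega -> R) (c : R)
    (g : T -> R) :
  measurable_fun setT Z -> measurable_fun setT h -> measurable_fun setT g ->
  (forall w, 0 <= h w)%R -> (forall x, 0 <= g x)%R -> (0 <= c)%R ->
  (forall B, measurable B ->
    \int[mu]_w (h w * \1_B (Z w))%:E = c%:E * \int[mu]_w (\1_B (Z w))%:E) ->
  \int[mu]_w (h w * g (Z w))%:E = c%:E * \int[mu]_w (g (Z w))%:E.
Proof.
move=> mZ mh mg h0 g0 c0 hB.
have mEg : measurable_fun setT (fun x => (g x)%:E) by exact/measurable_EFinP.
pose s := nnsfun_approx measurableT mEg.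
have ms n : measurable_fun setT (fun w => s n (Z w)).
  by apply: measurableT_comp => //.
have cs x : (s n x)%:E @[n --> \oo] --> (g x)%:E.
  by apply: (@cvg_nnsfun_approx _ _ _ _ measurableT _ mEg) => // y _;
    rewrite /= lee_fin.
have nds x : nondecreasing_seq (fun n => s n x).
  by move=> m n mn; exact/lefP/nd_nnsfun_approx.
have simple n : \int[mu]_w (h w * s n (Z w))%:E = c%:E * \int[mu]_w (s n (Z w))%:E.
  have sE x : s n x = (\sum_(y \in range (s n)) (`|y| * \1_(s n @^-1` [set y])
    x))%R.
    rewrite [LHS]fimfunE; apply: eq_fsbigr => y.
    by rewrite inE => -[z _ <-]; rewrite ger0_norm.
  have m1 y : measurable (s n @^-1` [set y]) by exact: measurable_sfunP.
  have m1Z y : measurable_fun setT (fun w => \1_(s n @^-1` [set y]) (Z w) : R).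
    by apply: measurableT_comp => //.
  under eq_integral do rewrite sE mulr_fsumr -fsumEFin//.
  rewrite ge0_integral_fsum//; last 2 first.
  - by move=> y; apply/measurable_EFinP/measurable_funM => //;
    apply: measurable_funM.
  - by move=> y w _; rewrite lee_fin !mulr_ge0.
  under [in RHS]eq_integral do rewrite sE -fsumEFin//.
  rewrite ge0_integral_fsum//; last first.
  - by move=> y; apply/measurable_EFinP/measurable_funM.
  rewrite ge0_mule_fsumr; last first.
    by move=> y; apply: integral_ge0 => w _; rewrite lee_fin !mulr_ge0.
  apply: eq_fsbigr => y _.
  under eq_integral do rewrite mulrCA EFinM.
  rewrite ge0_integralZl_EFin//; last 2 first.
  - by move=> w _; rewrite lee_fin mulr_ge0.
  - by apply/measurable_EFinP/measurable_funM.
  under [in RHS]eq_integral do rewrite EFinM.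
  rewrite [in RHS]ge0_integralZl_EFin//; last first.
  - exact/measurable_EFinP.
  by rewrite hB// muleCA.
have lim1 : \int[mu]_w (h w * s n (Z w))%:E @[n --> \oo] --> \int[mu]_w (h w * g
  (Z w))%:E.
  have -> : \int[mu]_w (h w * g (Z w))%:E = \int[mu]_w (limn (fun n =>
    (h w * s n (Z w))%:E)).
    apply: eq_integral => w _; apply/esym/cvg_lim => //.
    under eq_fun do rewrite EFinM.
    by rewrite EFinM; apply: cvgeZl => //.
  apply: cvg_monotone_convergence => //.
  - by move=> n; apply/measurable_EFinP/measurable_funM.
  - by move=> n w _; rewrite lee_fin mulr_ge0.
  - by move=> w _ m n mn; rewrite lee_fin ler_wpM2l// nds.
have lim2 : \int[mu]_w (s n (Z w))%:E @[n --> \oo] --> \int[mu]_w (g (Z w))%:E.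
  have -> : \int[mu]_w (g (Z w))%:E = \int[mu]_w (limn (fun n => (s n (Z w))%:E)).
    by apply: eq_integral => w _; apply/esym/cvg_lim.
  apply: cvg_monotone_convergence => //.
  - by move=> n; apply/measurable_EFinP.
  - by move=> n w _; rewrite lee_fin.
  - by move=> w _ m n mn; rewrite lee_fin nds.

have simple' : (fun n => \int[mu]_w (h w * s n (Z w))%:E) = (fun n =>
  c%:E * \int[mu]_w (s n (Z w))%:E).
  exact/funext.
rewrite simple' in lim1.
by apply: (cvg_unique _ lim1); [exact: ereal_hausdorff|exact: cvgeZl].
Qed.

End product_rule.

Section product_expectation.
Context {R : realType} {d d' : measure_display}
  {Omega : measurableType d} {T : measurableType d'} (P : probability Omega R).
Local Open Scope ereal_scope.

Lemma integral_bounded_fin_num (g : Omega -> R) (C : R) :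
  measurable_fun setT g -> (forall w, 0 <= g w <= C)%R ->
  \int[P]_w (g w)%:E \is a fin_num.
Proof.
move=> mg gC; rewrite ge0_fin_numE; last first.
  by apply: integral_ge0 => w _; rewrite lee_fin; have /andP[] := gC w.
apply: (@le_lt_trans _ _ (\int[P]_w (cst C%:E w))); last first.
  by rewrite integral_cst//= probability_setT mule1 ltry.
apply: ge0_le_integral => //.
- by move=> w _; rewrite lee_fin; have /andP[] := gC w.
- exact/measurable_EFinP.
- by move=> w _; rewrite lee_fin; have /andP[a b] := gC w; exact: le_trans b.
Qed.

Lemma ge0_integral_prod (I : finType) (Z : I -> Omega -> T) (C : R) :
  (1 <= C)%R -> (forall i, measurable_fun setT (Z i)) ->
  (forall B : I -> set T, (forall i, measurable (B i)) ->
    P (\bigcap_(i in [set: I]) (Z i @^-1` B i)) =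
    \prod_i P (Z i @^-1` B i)) ->
  forall g : I -> T -> R, (forall i, measurable_fun setT (g i)) ->
    (forall i x, 0 <= g i x <= C)%R ->
  \int[P]_w (\prod_i g i (Z i w))%:E = \prod_i \int[P]_w (g i (Z i w))%:E.
Proof.
move=> C1 mZ indep.
(* Induction on the list [s] of indices whose factor is arbitrary, all other factors being
   indicators. With [s] empty this is the assumed independence. *)
suff H (s : seq I) (g : I -> T -> R) : (forall i, measurable_fun setT (g i)) ->
    (forall i x, 0 <= g i x <= C)%R ->
    (forall i, i \notin s -> exists2 B, measurable B & g i = \1_B) ->
    \int[P]_w (\prod_i g i (Z i w))%:E = \prod_i \int[P]_w (g i (Z i w))%:E.
  move=> g mg gC; apply: (H (enum I)) => // i.
  by rewrite mem_enum.
elim: s g => [g mg gC gB|j s IH g mg gC gB].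
  have /choice[B BP] : forall i, exists B, measurable B /\ g i = \1_B.
    by move=> i; have [//|B] := gB i; exists B.
  have mB i : measurable (B i) by have [] := BP i.
  have mZB i : measurable (Z i @^-1` B i).
    by rewrite -[X in measurable X]setTI; exact: mZ.
  have gE i w : g i (Z i w) = \1_(Z i @^-1` B i) w.
    by have [_ ->] := BP i; rewrite !indicE.
  under [in RHS]eq_bigr => i _.
    under eq_integral do rewrite gE.
    rewrite integral_indic// setIT.
    over.
  rewrite -indep// -[in RHS](setIT (\bigcap_(i in _) _)) -integral_indic//;
    last first.
    by apply: fin_bigcap_measurable => //; exact: finite_finset.
  apply: eq_integral => w _; congr (_%:E).
  under eq_bigr do rewrite gE.
  rewrite indicE; have [|] := boolP (w \in _).
    by rewrite inE => wB; rewrite big1// => i _; rewrite indicE mem_set//;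
      exact: wB.
  move=> wB; have [i Bi] : exists i, ~ B i (Z i w).
    apply/existsNP => wB'; move/negP : wB; apply.
    by rewrite inE => i _; exact: wB'.
  by rewrite (bigD1 i)//= indicE memNset// mul0r.
rewrite (bigD1 j)//=.
pose h w := (\prod_(i | i != j) g i (Z i w))%R.
pose c := fine (\prod_(i | i != j) \int[P]_w (g i (Z i w))%:E).
have mgZ i : measurable_fun setT (fun w => g i (Z i w)).
  by apply: measurableT_comp.
have cE : \prod_(i | i != j) \int[P]_w (g i (Z i w))%:E = c%:E.
  rewrite fineK//; apply: prode_fin_num => i _.
  by apply: (@integral_bounded_fin_num _ C).
rewrite cE muleC.
under eq_integral do rewrite (bigD1 j)//= mulrC -/(h _).
have mh : measurable_fun setT h.
  by rewrite /h; under eq_fun do rewrite -big_filter; exact: measurable_prod.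
apply: (@ge0_integral_factor _ _ _ _ _ P (Z j) h c (g j)) => //.
- by move=> w; apply: prodr_ge0 => i _; have /andP[] := gC i (Z i w).
- by move=> x; have /andP[] := gC j x.
- rewrite -lee_fin -cE; apply: prode_ge0 => i _; apply: integral_ge0 => w _.
  by rewrite lee_fin; have /andP[] := gC i (Z i w).
move=> B mB.
(* With the factor at [j] replaced by an indicator the induction hypothesis applies. The assumption
   [1 <= C] keeps this indicator within the common bound. *)
pose g' i := if i == j then \1_B : T -> R else g i.
have g'j i : i != j -> g' i = g i by move=> /negbTE ij; rewrite /g' ij.
have gjj : g' j = \1_B by rewrite /g' eqxx.
have := IH g'; rewrite (bigD1 j)//= gjj (eq_bigr (fun i =>
  \int[P]_w (g i (Z i w))%:E)).
  rewrite cE muleC => <-.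
  - apply: eq_integral => w _; rewrite (bigD1 j)//= gjj mulrC; congr (_ * _)%:E.
    by apply: eq_bigr => i ij; rewrite g'j.
  - move=> i; have [->|ij] := eqVneq i j; first by rewrite gjj.
    by rewrite g'j.
  - move=> i x; have [->|ij] := eqVneq i j; last by rewrite g'j.
    by rewrite gjj indicE; case: (_ \in _); apply/andP; split => //;
      exact: le_trans C1.
  - move=> i; have [-> _|ij nis] := eqVneq i j; first by exists B; rewrite ?gjj.
    by rewrite g'j//; apply: gB; rewrite inE negb_or ij.
by move=> i ij; rewrite g'j.
Qed.

End product_expectation.

(** * Maximal inequality for stable integrals *)

Lemma nneseries_geometric (R : realType) (a z : R) : `|z| < 1 ->
  (\sum_(k <oo) (a * z ^+ k)%:E = (a / (1 - z))%:E)%E.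
Proof.
move=> z1; apply/cvg_lim => //.
under eq_fun do rewrite sumEFin.
apply: cvg_EFin; first by near=> n.
exact: (cvg_geometric_series z1).
Unshelve. all: by end_near.
Qed.

Lemma powRN_lt1 (R : realType) (a x : R) : 1 < a -> 0 < x -> a `^ (- x) < 1.
Proof.
move=> a1 x0; rewrite /powR gt_eqF ?(lt_trans ltr01)//.
by rewrite -[ltRHS]expR0 ltr_expR mulNr oppr_lt0 mulr_gt0 ?ln_gt0.
Qed.

Section stable_variable.
Context {R : realType} {d dT : measure_display}
  {Omega : measurableType d} {T : measurableType dT}.
Variables (P : probability Omega R) (alpha : R).
Variables (Delta : {measure set T -> \bar R}) (M : set T -> Omega -> R[i]).
Hypothesis alpha_gt0 : 0 < alpha.
Hypothesis alpha_lt2 : alpha < 2.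
Hypothesis rsmM : rot_inv_stable_random_measure P alpha Delta M.
Local Open Scope ereal_scope.

Definition lin_re_im (a b : R) (z : R[i]) : R :=
  (a * complex.Re z + b * complex.Im z)%R.

Lemma measurable_lin_re_im a b A : finite_measure_set Delta A ->
  measurable_fun setT (fun w => lin_re_im a b (M A w)).
Proof.
move=> fA; have [mr mi] := rsm_measurable rsmM fA.
by apply: measurable_funD; apply: measurable_funM.
Qed.

Lemma measurable_sin_comp (f : Omega -> R) :
  measurable_fun setT f -> measurable_fun setT (fun w => sin (f w)).
Proof.
move=> mf; apply: measurableT_comp => //.
by apply: continuous_measurable_fun; exact: continuous_sin.
Qed.

Lemma measurable_cos_comp (f : Omega -> R) :
  measurable_fun setT f -> measurable_fun setT (fun w => cos (f w)).
Proof.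
move=> mf; apply: measurableT_comp => //.
by apply: continuous_measurable_fun; exact: continuous_cos.
Qed.

(** Minus the logarithm of the characteristic function of [M A] at any point of modulus [c]. *)
Definition stable_scale (A : set T) (c : R) : R := (fine (Delta A) * c `^ alpha)%R.

Lemma integrable_bounded (f : Omega -> R) (C : R) :
  measurable_fun setT f -> (forall w, `|f w| <= C)%R ->
  P.-integrable setT (fun w => (f w)%:E).
Proof.
move=> mf fC; apply: measurable_bounded_integrable => //.
  exact: (le_lt_trans (probability_le1 P measurableT) (ltry _)).
exists C; split; first exact: num_real.
by move=> x Cx w _; exact: le_trans (fC w) (ltW Cx).
Qed.

(** Real and imaginary parts of the characteristic function at [a + i b]. Its value is real, so the
    sine has mean zero: this is the only centering available, since [M A] need not have a first
    moment. *)
Lemma rsm_charfun (A : set T) (a b : R) : finite_measure_set Delta A ->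
  \int[P]_w (cos (lin_re_im a b (M A w)))%:E =
    (expR (- stable_scale A (Num.sqrt (a ^+ 2 + b ^+ 2))))%:E /\
  \int[P]_w (sin (lin_re_im a b (M A w)))%:E = 0.
Proof.
move=> fA.
have := rsm_stable rsmM (Complex a b) fA.
have linE w : complex.Re ((Complex a b)^* * M A w)%R = lin_re_im a b (M A w).
  by case: (M A w) => x y; rewrite /lin_re_im /= mulNr opprK.
have ml := measurable_lin_re_im a b fA.
have fc : \int[P]_w (cos (lin_re_im a b (M A w)))%:E \is a fin_num.
  apply: integrable_fin_num => //; apply: (@integrable_bounded _ 1%R).
    exact: measurable_cos_comp.
  by move=> w; rewrite ler_norml cos_geN1 cos_le1.
have fs : \int[P]_w (sin (lin_re_im a b (M A w)))%:E \is a fin_num.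
  apply: integrable_fin_num => //; apply: (@integrable_bounded _ 1%R).
    exact: measurable_sin_comp.
  by move=> w; rewrite ler_norml sin_geN1 sin_le1.
rewrite /cexpectation unlock /= => -[].
under eq_integral do rewrite linE.
move=> e1.
under eq_integral do rewrite linE.
move=> e2; split.
  by rewrite -(fineK fc) e1.
by rewrite -(fineK fs) e2.
Qed.

Lemma integral_1Bcos_le (A : set T) (a b : R) : finite_measure_set Delta A ->
  \int[P]_w (1 - cos (lin_re_im a b (M A w)))%:E <=
  (stable_scale A (Num.sqrt (a ^+ 2 + b ^+ 2)))%:E.
Proof.
move=> fA; have [h _] := rsm_charfun a b fA.
have ml := measurable_lin_re_im a b fA.
under eq_integral do rewrite EFinB.
rewrite integralB_EFin//.
- rewrite h integral_cst//= probability_setT mule1 -EFinB lee_fin.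
  exact: expRB1_le.
- by apply: (@integrable_bounded (fun=> 1%R) 1%R) => // w; rewrite normr1.
- apply: (@integrable_bounded _ 1%R).
    exact: measurable_cos_comp.
  by move=> w; rewrite ler_norml cos_geN1 cos_le1.
Qed.

Lemma sqr_sin_le (x : R) : (sin x ^+ 2 <= 2 * (1 - cos x))%R.
Proof.
have := cos2Dsin2 x; have := cos_le1 x; have := cos_geN1 x.
by set c := cos x; set s := sin x; nra.
Qed.

(** In [expR s <= 1 + s + 2 s^2] with [s = sin x], the linear term integrates to 0 and
    [2 sin^2 x <= 4 (1 - cos x)]. The expectation is thus at most 1 plus 4 times the scale. *)
Lemma integral_expR_sin_le (A : set T) (a b : R) : finite_measure_set Delta A ->
  \int[P]_w (expR (sin (lin_re_im a b (M A w))))%:E <=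
  (expR (4 * stable_scale A (Num.sqrt (a ^+ 2 + b ^+ 2))))%:E.
Proof.
move=> fA; have [_ h] := rsm_charfun a b fA.
have ml := measurable_lin_re_im a b fA.
have msin := measurable_sin_comp ml.
have mcos := measurable_cos_comp ml.
apply: (@le_trans _ _ (\int[P]_w ((1 + sin (lin_re_im a b (M A w)))%:E +
    (4 * (1 - cos (lin_re_im a b (M A w))))%:E))).
  apply: ge0_le_integral => //.
  - by apply/measurable_EFinP; apply: measurableT_comp.
  - by apply: emeasurable_funD; apply/measurable_EFinP;
      [apply: measurable_funD|apply: measurable_funM => //; apply: measurable_funB].
  - move=> w _; rewrite -EFinD lee_fin.
    have hs : (`|sin (lin_re_im a b (M A w))| <= 1)%R.
      by rewrite ler_norml sin_geN1 sin_le1.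
    have := expR_le_quad hs; have := sqr_sin_le (lin_re_im a b (M A w)).
    lra.
rewrite ge0_integralD//.
- under eq_integral do rewrite EFinD.
  rewrite integralD_EFin//.
  + rewrite h adde0 integral_cst//= probability_setT mule1.
    under eq_integral do rewrite EFinM.
    rewrite ge0_integralZl_EFin//.
    * apply: (@le_trans _ _ (1 + 4%:E *
        (stable_scale A (Num.sqrt (a ^+ 2 + b ^+ 2)))%:E)).
        by rewrite leeD2l// lee_wpmul2l//; exact: integral_1Bcos_le.
      by rewrite -EFinM -EFinD lee_fin expR_ge1Dx.
    * by apply/measurable_EFinP; apply: measurable_funB.
  + by apply: (@integrable_bounded (fun=> 1%R) 1%R) => // w; rewrite normr1.
  + apply: (@integrable_bounded _ 1%R) => // w.
    by rewrite ler_norml sin_geN1 sin_le1.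
- by apply/measurable_EFinP; apply: measurable_funD.
- by apply/measurable_EFinP; apply: measurable_funM => //; apply: measurable_funB.
Qed.

Lemma measurable_qpow p : measurable_fun setT (@qpow R p).
Proof.
apply: measurable_fun_ifT => //=.
- by apply: measurable_fun_ler.
- exact: (measurableT_comp (measurable_powR p) (@normr_measurable _ _)).
Qed.

(** The 16 comes from [qpow_le], the denominator from a geometric series of ratio [2^(-alpha/2)]. *)
Definition qpow_const : R := (16 / (1 - 2 `^ (- (alpha / 2))))%R.

Lemma qpow_const_gt0 : (0 < qpow_const)%R.
Proof.
rewrite divr_gt0// subr_gt0; apply: powRN_lt1; first by rewrite ltr1n.
by rewrite divr_gt0.
Qed.

(* [sum_k 2^(k p) (1 - cos (y / 2^k))] dominates [qpow p y], and its expectation *)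
(* is read off the characteristic function.                                      *)
Lemma integral_qpow_le (A : set T) (a b : R) : finite_measure_set Delta A ->
  \int[P]_w (qpow (alpha / 2) (lin_re_im a b (M A w)))%:E <=
  (qpow_const * stable_scale A (Num.sqrt (a ^+ 2 + b ^+ 2)))%:E.
Proof.
move=> fA; set p := (alpha / 2)%R.
have p0 : (0 < p)%R by rewrite divr_gt0.
have p1 : (p <= 1)%R by rewrite ler_pdivrMr// mul1r ltW.
set l := fun w => lin_re_im a b (M A w).
set s := stable_scale _ _.
have ml : measurable_fun setT l := measurable_lin_re_im a b fA.
pose f (k : nat) (w : Omega) : \bar R :=
  (16 * ((2 ^+ k) `^ p * (1 - cos (l w / 2 ^+ k))))%:E.
have mlk k : measurable_fun setT (fun w => 1 - cos (l w / 2 ^+ k))%R.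
  by apply: measurable_funB => //; apply: measurable_cos_comp;
    apply: measurable_funM.
have mf k : measurable_fun setT (f k).
  by apply/measurable_EFinP; apply: measurable_funM => //; apply: measurable_funM.
have f0 k w : 0 <= f k w.
  by rewrite lee_fin !mulr_ge0 ?powR_ge0// subr_ge0 cos_le1.
apply: (@le_trans _ _ (\int[P]_w (\sum_(k <oo) f k w))).
  apply: ge0_le_integral => //.
  - by move=> w _; rewrite lee_fin qpow_ge0.
  - by apply/measurable_EFinP; apply: measurableT_comp => //;
    exact: measurable_qpow.
  - by apply: ge0_emeasurable_sum => //.
  - move=> w _; have [k hk] := qpow_le (l w) p0 p1.
    apply: (@le_trans _ _ (f k w)); first by rewrite lee_fin.
    rewrite (nneseries_split _ k.+1)//.
    rewrite add0n big_nat_recr//= -addeA; apply: lee_paddl.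
      by apply: sume_ge0 => *; exact: f0.
    by rewrite leeDl// nneseries_ge0.
rewrite integral_nneseries//.
(* Dividing the variable by [2^k] divides its scale by [2^(k alpha)]. As [alpha = 2 p], the weight
   [2^(k p)] leaves [2^(- k p)]. *)
have fk k : \int[P]_w f k w <= (16 * s * (2 `^ (- p)) ^+ k)%:E.
  have k0 : (0 < 2 ^+ k :> R)%R by rewrite exprn_gt0.
  rewrite /f; under eq_integral do rewrite mulrA EFinM.
  rewrite ge0_integralZl_EFin//; last first.
  - exact/measurable_EFinP.
  have lE w : (l w / 2 ^+ k)%R = lin_re_im (a / 2 ^+ k) (b / 2 ^+ k) (M A w).
    by rewrite /l /lin_re_im mulrDl !(mulrAC _ _ (2 ^+ k)^-1)%R.
  under eq_integral do rewrite lE.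
  have h := integral_1Bcos_le (a / 2 ^+ k) (b / 2 ^+ k) fA.
  apply: (le_trans (lee_wpmul2l _ h)).
    by rewrite lee_fin mulr_ge0// powR_ge0.
  rewrite -EFinM lee_fin /s /stable_scale.
  have -> : Num.sqrt ((a / 2 ^+ k) ^+ 2 + (b / 2 ^+ k) ^+ 2) =
      (Num.sqrt (a ^+ 2 + b ^+ 2) / 2 ^+ k)%R.
    rewrite !exprMn -mulrDl sqrtrM ?addr_ge0 ?sqr_ge0//.
    by rewrite sqrtr_sqr ger0_norm// invr_ge0 ltW.
  rewrite powRM ?sqrtr_ge0 ?invr_ge0 ?(ltW k0)//.
  have -> : ((2 ^+ k)^-1 `^ alpha = (2 ^+ k) `^ (- p) * (2 ^+ k) `^ (- p))%R.
    rewrite -powRD; last by rewrite (gt_eqF k0) implybT.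
    have -> : ((2 ^+ k)^-1 = (2 ^+ k) `^ (- 1) :> R)%R.
      by rewrite powR_inv1// ltW.
    by rewrite -powRrM mulN1r -opprD -splitr.
  have e : ((2 ^+ k) `^ p * (2 ^+ k) `^ (- p) = 1)%R.
    by rewrite powRN mulfV// gt_eqF// powR_gt0.
  have -> : ((2 `^ (- p)) ^+ k = (2 ^+ k) `^ (- p))%R.
    rewrite -(powR_mulrn k (powR_ge0 2 (- p))) -(powR_mulrn k (ler0n R 2)).
    by rewrite -!powRrM mulrC.
  have alg (u v x y : R) : (x * y = 1 ->
      16 * x * (u * (v * (y * y))) = 16 * (u * v) * y)%R.
    move=> xy; transitivity (16 * (u * v) * y * (x * y))%R; first by ring.
    by rewrite xy mulr1.
  by rewrite alg.
have s0 : (0 <= s)%R.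
  by rewrite mulr_ge0 ?powR_ge0// fine_ge0.
apply: (le_trans (lee_nneseries _ (fun k _ => fk k))).
  by move=> k _ _; apply: integral_ge0.
have r1 : (`|2 `^ (- p)| < 1 :> R)%R.
  by rewrite ger0_norm ?powR_ge0//; apply: powRN_lt1; rewrite ?ltr1n.
rewrite nneseries_geometric//.
by rewrite lee_fin /qpow_const mulrAC.
Qed.

End stable_variable.

(** * Union bound and Markov inequality *)

Section finite_measure_bounds.
Context {R : realType} {d : measure_display} {Omega : measurableType d}.
Variable P : probability Omega R.
Local Open Scope ereal_scope.

Lemma fin_exists_bigsetU (E : finType) (F : E -> set Omega) :
  [set w | exists e, F e w] = \big[setU/set0]_(e <- enum E) F e.
Proof.
rewrite -bigcup_seq; apply/seteqP; split => w /=.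
  by move=> [e Few]; exists e => //=; rewrite mem_enum.
by move=> [e _ Few]; exists e.
Qed.

Lemma measurable_fin_exists (E : finType) (F : E -> set Omega) :
  (forall e, measurable (F e)) -> measurable [set w | exists e, F e w].
Proof.
by move=> mF; rewrite fin_exists_bigsetU; apply: bigsetU_measurable.
Qed.

Lemma measure_fin_exists_le (E : finType) (F : E -> set Omega) (b : R) :
  (forall e, measurable (F e)) -> (forall e, P (F e) <= b%:E) ->
  P [set w | exists e, F e w] <= (#|E|%:R * b)%:E.
Proof.
move=> mF Fb; rewrite fin_exists_bigsetU cardE.
elim: (enum E) => [|e s IH]; first by rewrite big_nil measure0 mul0r.
rewrite big_cons /= -natr1 mulrDl mul1r EFinD addeC.
apply: (le_trans (measureU2 _ _ _)) => //; first exact: bigsetU_measurable.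
by apply: leeD; [exact: Fb|exact: IH].
Qed.

Lemma measurable_ge_cst (t : R) (g : Omega -> R) : measurable_fun setT g ->
  measurable [set w | (t <= g w)%R].
Proof.
move=> mg; rewrite -[X in measurable X]setTI.
exact: (measurable_fun_le measurableT (@measurable_cst _ _ _ _ setT t) mg).
Qed.

Lemma measurable_gt_cst (t : R) (g : Omega -> R) : measurable_fun setT g ->
  measurable [set w | (t < g w)%R].
Proof.
move=> mg; rewrite (_ : [set w | _] = ~` [set w | (g w <= t)%R]).
  apply: measurableC; rewrite -[X in measurable X]setTI.
  exact: (measurable_fun_le measurableT mg (@measurable_cst _ _ _ _ setT t)).
by apply/seteqP; split => w /=; rewrite ltNge => /negP.
Qed.

Lemma markov_ge0 (g : Omega -> R) (t c : R) : measurable_fun setT g ->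
  (forall w, 0 <= g w)%R -> (0 < t)%R -> \int[P]_w (g w)%:E <= c%:E ->
  P [set w | (t <= g w)%R] <= (c / t)%:E.
Proof.
move=> mg g0 t0 gc.
have mEg : measurable_fun setT (fun w => (g w)%:E) by exact/measurable_EFinP.
have h := le_integral_abse P measurableT mEg t0.
rewrite setTI in h.
have e : [set x | t%:E <= `|(g x)%:E|] = [set w | (t <= g w)%R].
  by apply/seteqP; split => w /=; rewrite lee_fin ger0_norm.
rewrite e in h; rewrite mulrC EFinM lee_pdivlMl//.
apply: le_trans gc; apply: (le_trans h).
rewrite le_eqVlt; apply/orP; left; apply/eqP; apply: eq_integral => w _.
by rewrite gee0_abs// lee_fin.
Qed.

End finite_measure_bounds.

(** * Maximal inequality for simple integrals over disjoint sets *)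

Section disjoint_sums.
Context {R : realType} {d dT : measure_display}
  {Omega : measurableType d} {T : measurableType dT}.
Variables (P : probability Omega R) (alpha : R).
Variables (Delta : {measure set T -> \bar R}) (M : set T -> Omega -> R[i]).
Hypothesis alpha_gt0 : 0 < alpha.
Hypothesis alpha_lt2 : alpha < 2.
Hypothesis rsmM : rot_inv_stable_random_measure P alpha Delta M.
Variables (I : finType) (A : I -> set T).
Hypothesis finA : forall i, finite_measure_set Delta (A i).
Hypothesis trivA : trivIset setT A.
Local Open Scope ereal_scope.

Let Z (i : I) (w : Omega) : R * R :=
  (complex.Re (M (A i) w), complex.Im (M (A i) w)).

Lemma rsm_independent_fin (B : I -> set (R * R)) :
  (forall i, measurable (B i)) ->
  P (\bigcap_(i in [set: I]) (Z i @^-1` B i)) = \prod_i P (Z i @^-1` B i).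
Proof.
move=> mB.
have trivA' : trivIset setT (A \o (@enum_val I I)).
  apply/trivIsetP => i j _ _ ij; move/trivIsetP : trivA; apply => //.
  by apply: contra ij => /eqP/enum_val_inj ->.
have := rsm_independently_scattered rsmM (fun j => finA (enum_val j)) trivA'
  (fun j => mB (enum_val j)).
rewrite (big_enum_val (fun i => P (Z i @^-1` B i))) => <-.
congr (P _); apply/seteqP; split => w h i _; first exact: h.
by rewrite -(enum_rankK i); exact: (h (enum_rank i)).
Qed.

(** By independence the exponential of the sum factorizes. Each factor lies between 0 and [expR 1],
    so the product rule for bounded functions is enough. *)
Lemma integral_expR_sum_sin_le (a b : I -> R) :
  \int[P]_w (expR (\sum_i sin (lin_re_im (a i) (b i) (M (A i) w))))%:E <=
  (expR (4 * \sum_i stable_scale alpha Delta (A i)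
                      (Num.sqrt (a i ^+ 2 + b i ^+ 2))))%:E.
Proof.
pose g (i : I) (z : R * R) := expR (sin (a i * z.1 + b i * z.2)).
have mg i : measurable_fun setT (g i).
  apply: measurableT_comp; first exact: measurable_expR.
  apply: measurable_sin_comp.
  by apply: measurable_funD; apply: measurable_funM.
have g0 i z : (0 <= g i z <= expR 1)%R by rewrite expR_ge0 ler_expR sin_le1.
have mZ i : measurable_fun setT (Z i).
  by apply: measurable_fun_pair; have [mr mi] := rsm_measurable rsmM (finA i).
have e1 : (1 <= expR 1 :> R)%R by rewrite -[leLHS]expR0 ler_expR.
have mgZ i : measurable_fun setT (fun w => g i (Z i w)).
  by apply: measurableT_comp.
have := ge0_integral_prod e1 mZ rsm_independent_fin mg g0.
under eq_integral do rewrite -expR_sum.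
move=> ->.
have gfin i : \int[P]_w (g i (Z i w))%:E \is a fin_num.
  by apply: (@integral_bounded_fin_num _ _ _ _ _ (expR 1)).
under eq_bigr do rewrite -(fineK (gfin _)).
rewrite prodEFin lee_fin mulr_sumr expR_sum.
apply: ler_prod => i _; rewrite fine_ge0 ?integral_ge0//=.
  by rewrite -lee_fin fineK//; exact: (integral_expR_sin_le rsmM).
by move=> w _; rewrite lee_fin expR_ge0.
Qed.

Variables (E : finType) (c : E -> I -> R[i]) (D : I -> R) (L : R).
Hypothesis D_ge0 : forall i, (0 <= D i)%R.
Hypothesis cD : forall e i, (Normc.normc (c e i) <= D i)%R.
Hypothesis DL : (\sum_i stable_scale alpha Delta (A i) (D i) <= L)%R.

Lemma normc_sqrtE (z : R[i]) :
  Normc.normc z = Num.sqrt (complex.Re z ^+ 2 + complex.Im z ^+ 2).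
Proof. by case: z. Qed.

Lemma Re_mulE (z1 z2 : R[i]) :
  complex.Re (z1 * z2)%R = lin_re_im (complex.Re z1) (- complex.Im z1) z2.
Proof. by case: z1 => a b; case: z2 => x y; rewrite /lin_re_im /= mulNr. Qed.

Lemma normr_Re_le (z : R[i]) : (`|complex.Re z| <= Normc.normc z)%R.
Proof.
by rewrite normc_sqrtE -sqrtr_sqr ler_wsqrtr// lerDl sqr_ge0.
Qed.

Lemma normr_Im_le (z : R[i]) : (`|complex.Im z| <= Normc.normc z)%R.
Proof.
by rewrite normc_sqrtE -sqrtr_sqr ler_wsqrtr// lerDr sqr_ge0.
Qed.

Lemma stable_scale_le B (x y : R) : (0 <= x)%R -> (x <= y)%R ->
  (stable_scale alpha Delta B x <= stable_scale alpha Delta B y)%R.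
Proof.
move=> x0 xy; rewrite ler_wpM2l ?fine_ge0//.
by rewrite ge0_ler_powR ?nnegrE ?(ltW alpha_gt0)// (le_trans x0).
Qed.

Let x (e : E) (i : I) (w : Omega) := complex.Re (c e i * M (A i) w)%R.

Let xE e i w : x e i w = lin_re_im (complex.Re (c e i)) (- complex.Im (c e i)) (M
  (A i) w).
Proof. exact: Re_mulE. Qed.

Let mx e i : measurable_fun setT (x e i).
Proof.
rewrite (funext (xE e i)).
exact: (measurable_lin_re_im rsmM).
Qed.

(** The exponential Markov inequality for both signs of the sum. As sine is odd, the sign goes into
    the coefficients, where it does not change their modulus. *)
Lemma prob_sum_sin_gt (e : E) (lam : R) :
  P [set w | (lam <= `|\sum_i sin (x e i w)|)%R] <= (2 * expR (4 * L - lam))%:E.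
Proof.
have ms : measurable_fun setT (fun w => \sum_i sin (x e i w))%R.
  by apply: measurable_sum => i; exact: measurable_sin_comp.
have half (s : R) : (s ^+ 2 = 1)%R ->
    P [set w | (expR lam <= expR (\sum_i sin (s * x e i w)))%R] <=
    (expR (4 * L - lam))%:E.
  move=> s1.
  have mss : measurable_fun setT (fun w => \sum_i sin (s * x e i w))%R.
    by apply: measurable_sum => i; apply: measurable_sin_comp;
      apply: measurable_funM.
  rewrite expRB; apply: markov_ge0.
  - by apply: measurableT_comp.
  - by move=> w; exact: expR_ge0.
  - exact: expR_gt0.
  have sxE i w : (s * x e i w)%R = lin_re_im (s * complex.Re (c e i)) (s * -
    complex.Im (c e i)) (M (A i) w).
    by rewrite xE /lin_re_im mulrDr !mulrA.
  under eq_integral do under eq_bigr do rewrite sxE.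
  apply: (le_trans (integral_expR_sum_sin_le _ _)).
  rewrite lee_fin ler_expR ler_pM2l//; apply: le_trans DL.
  apply: ler_sum => i _; apply: stable_scale_le; first exact: sqrtr_ge0.
  by rewrite !exprMn s1 !mul1r sqrrN -normc_sqrtE.
have mh (s : R) : measurable [set w | (expR lam <= expR (\sum_i sin (s * x e i
  w)))%R].
  apply: measurable_ge_cst.
  apply: measurableT_comp => //.
  by apply: measurable_sum => i; apply: measurable_sin_comp; apply: measurable_funM.
rewrite (_ : [set w | _] = [set w | (expR lam <= expR (\sum_i sin (1 * x e i
  w)))%R] `|`
    [set w | (expR lam <= expR (\sum_i sin (-1 * x e i w)))%R]).
  apply: (le_trans (measureU2 _ _ _)) => //.
  rewrite mulr2n mulrDl mul1r EFinD; apply: leeD; apply: half;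
    rewrite ?sqrrN expr1n//.
apply/seteqP; split => w /=.
all: rewrite !ler_expR.
all: under [in X in X \/ _]eq_bigr do rewrite mul1r.
all: under [in X in _ \/ X]eq_bigr do rewrite mulN1r sinN.
all: rewrite sumrN ler_normr => ?; exact/orP.
Qed.

Let p := (alpha / 2)%R.
(** Only the dominating coefficients [D i] occur, not the edge, so the single event [Q w <= q]
    serves all edges. The factor 2 is there because a product [c * M (A i) w] with [|c| <= D i] has
    real part at most [2 * D i] times the larger of the absolute values of the real and imaginary
    parts of [M (A i) w]. *)
Let Q (w : Omega) : R := (\sum_i
  (qpow p (lin_re_im (2 * D i) 0 (M (A i) w)) +
   qpow p (lin_re_im 0 (2 * D i) (M (A i) w))))%R.

Let mqpow a b i :
  measurable_fun setT (fun w => qpow p (lin_re_im a b (M (A i) w))).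
Proof.
exact: (measurableT_comp (measurable_qpow p) (measurable_lin_re_im rsmM a b (finA
  i))).
Qed.

Let mQ : measurable_fun setT Q.
Proof.
by apply: measurable_sum => i; apply: measurable_funD; exact: mqpow.
Qed.

Lemma integral_remainder_le : \int[P]_w (Q w)%:E <= (8 * qpow_const alpha * L)%:E.
Proof.
have q0 := qpow_const_gt0 alpha_gt0.
under eq_integral do rewrite -sumEFin.
rewrite ge0_integral_sum//; last 2 first.
- move=> i; by apply/measurable_EFinP; apply: measurable_funD; exact: mqpow.
- by move=> i w _; rewrite lee_fin addr_ge0// qpow_ge0.
apply: (@le_trans _ _ (\sum_i (8 * qpow_const alpha * stable_scale alpha Delta (A
  i) (D i))%:E)); last first.
  by rewrite sumEFin lee_fin -mulr_sumr ler_wpM2l// mulr_ge0// ltW.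
apply: lee_sum => i _; have Di := D_ge0 i.
under eq_integral do rewrite EFinD.
rewrite ge0_integralD//.
all: try by move=> w _; rewrite lee_fin qpow_ge0.
all: try by apply/measurable_EFinP; exact: mqpow.
have h1 := integral_qpow_le alpha_gt0 alpha_lt2 rsmM (2 * D i) 0 (finA i).
have h2 := integral_qpow_le alpha_gt0 alpha_lt2 rsmM 0 (2 * D i) (finA i).
apply: (le_trans (leeD h1 h2)).
(* The constant 8: two functionals for each [i], and [2^alpha <= 4] from the coefficient
   [2 * D i]. *)
rewrite -EFinD lee_fin -mulrDr !expr0n/= addr0 add0r.
rewrite sqrtr_sqr ger0_norm ?mulr_ge0// /stable_scale powRM//.
have p4 : (2 `^ alpha <= 4 :> R)%R.
  apply: (@le_trans _ _ (2 `^ 2%:R)%R); last by rewrite powR_mulrn// -natrX.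
  by rewrite ler_powR ?ler1n// ltW.
have s0 : (0 <= fine (Delta (A i)) * D i `^ alpha)%R.
  by rewrite mulr_ge0 ?powR_ge0// fine_ge0.
rewrite mulrCA; set u := (fine _ * _)%R in s0 *; set v := (2 `^ alpha)%R in p4 *.
rewrite -mulr2n -mulr_natl.
have : (qpow_const alpha * u * v <= qpow_const alpha * u * 4)%R.
  by rewrite ler_wpM2l// mulr_ge0// ltW.
lra.
Qed.

(** Each remainder is at most [2 * q]^ (1/p - 1)[times its share of]Q
    w[, and the shares add up to at most]q[, which gives]2 * q [^ (1/p)] with [1/p = 2/alpha]. *)
Lemma sum_subsin_le (e : E) (q : R) (w : Omega) : (1 <= q)%R -> (Q w <= q)%R ->
  (`|\sum_i (x e i w - sin (x e i w))| <= 2 * q `^ (2 / alpha))%R.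
Proof.
move=> q1 Qq; have p0 : (0 < p)%R by rewrite divr_gt0.
have p1 : (p <= 1)%R by rewrite ler_pdivrMr// mul1r ltW.
have q0 := lt_le_trans ltr01 q1.
apply: (@le_trans _ _ (\sum_i 2 * ((qpow p (lin_re_im (2 * D i) 0 (M (A i) w)) +
   qpow p (lin_re_im 0 (2 * D i) (M (A i) w))) * q `^ (p^-1 - 1)))%R); last first.
  rewrite -mulr_sumr -mulr_suml -/(Q w) ler_pM2l//.
  have -> : (q `^ (2 / alpha) = q * q `^ (p^-1 - 1))%R.
    rewrite -{2}(powRr1 (ltW q0)) -powRD; last by rewrite (gt_eqF q0) implybT.
    by rewrite subrKC /p invf_div.
  by rewrite ler_wpM2r// powR_ge0.
apply: (le_trans (ler_norm_sum _ _ _)); apply: ler_sum => i _.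
have Di := D_ge0 i.
have Qi : (qpow p (lin_re_im (2 * D i) 0 (M (A i) w)) +
   qpow p (lin_re_im 0 (2 * D i) (M (A i) w)) <= q)%R.
  apply: le_trans Qq; rewrite /Q (bigD1 i)//= lerDl.
  by apply: sumr_ge0 => j _; rewrite addr_ge0// qpow_ge0.
set y1 := lin_re_im (2 * D i) 0 _ in Qi *; set y2 := lin_re_im 0 _ _ in Qi *.
have y10 := qpow_ge0 p y1; have y20 := qpow_ge0 p y2.
have xle : (`|x e i w| <= D i * `|complex.Re (M (A i) w)| + D i * `|complex.Im (M
  (A i) w)|)%R.
  rewrite xE /lin_re_im (le_trans (ler_normD _ _))// !normrM normrN.
  have hr := le_trans (normr_Re_le (c e i)) (cD e i).
  have hi := le_trans (normr_Im_le (c e i)) (cD e i).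
  by apply: lerD; apply: ler_wpM2r.
have y1E : (`|y1| = 2 * (D i * `|complex.Re (M (A i) w)|))%R.
  by rewrite /y1 /lin_re_im mul0r addr0 !normrM (ger0_norm Di) ger0_norm// mulrA.
have y2E : (`|y2| = 2 * (D i * `|complex.Im (M (A i) w)|))%R.
  by rewrite /y2 /lin_re_im mul0r add0r !normrM (ger0_norm Di) ger0_norm// mulrA.
(* The larger of the two parts of [M (A i) w] decides which of [y1], [y2] dominates [x e i w]. *)
have [h|h] := leP (D i * `|complex.Re (M (A i) w)|)%R
  (D i * `|complex.Im (M (A i) w)|)%R.
  have xy : (`|x e i w| <= `|y2|)%R by lra.
  have y2q : (qpow p y2 <= q)%R by lra.
  apply: (le_trans (normr_subsin_qpow p0 p1 q1 xy y2q)).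
  by rewrite ler_pM2l// ler_wpM2r ?powR_ge0// lerDr.
have xy : (`|x e i w| <= `|y1|)%R by lra.
have y1q : (qpow p y1 <= q)%R by lra.
apply: (le_trans (normr_subsin_qpow p0 p1 q1 xy y1q)).
by rewrite ler_pM2l// ler_wpM2r ?powR_ge0// lerDl.
Qed.

Lemma disjoint_maximal_inequality (q lam : R) : (1 <= q)%R ->
  P [set w | exists e, (2 * q `^ (2 / alpha) + lam <
      `|complex.Re (\sum_i c e i * M (A i) w)%R|)%R] <=
  (8 * qpow_const alpha * L / q + #|E|%:R * (2 * expR (4 * L - lam)))%:E.
Proof.
move=> q1; have q0 := lt_le_trans ltr01 q1.
have msS e : measurable [set w | (lam <= `|\sum_i sin (x e i w)|)%R].
  apply: measurable_ge_cst.
  apply: measurableT_comp => //.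
  by apply: measurable_sum => i; exact: measurable_sin_comp.
have mxe e : measurable_fun setT (fun w => complex.Re (\sum_i c e i * M (A i) w)%R).
  under eq_fun do rewrite raddf_sum.
  by apply: measurable_sum => i; exact: mx.
have mQq : measurable [set w | (q <= Q w)%R].
  exact: measurable_ge_cst.
have mlhs : measurable [set w | exists e, (2 * q `^ (2 / alpha) + lam <
      `|complex.Re (\sum_i c e i * M (A i) w)%R|)%R].
  apply: measurable_fin_exists => e.
  apply: measurable_gt_cst.
  by apply: measurableT_comp.
apply: (@le_trans _ _ (P ([set w | (q <= Q w)%R] `|`
    [set w | exists e, (lam <= `|\sum_i sin (x e i w)|)%R]))).
  apply: le_measure; rewrite ?inE//.
    by apply: measurableU => //; exact: measurable_fin_exists.
  move=> w /= [e he]; have [|Qq] := leP q (Q w); first by left.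
  right; exists e; have := sum_subsin_le e q1 (ltW Qq).
  have heE : complex.Re (\sum_i c e i * M (A i) w)%R =
      (\sum_i (x e i w - sin (x e i w)) + \sum_i sin (x e i w))%R.
    rewrite raddf_sum -big_split; apply: eq_bigr => i _.
    by rewrite /= subrK.
  rewrite heE in he.
  move=> h; have := ler_normD (\sum_i (x e i w - sin (x e i w)))%R (\sum_i sin (x
    e i w))%R.
  lra.
apply: (le_trans (measureU2 _ _ _)) => //; first exact: measurable_fin_exists.
rewrite EFinD; apply: leeD.
  apply: markov_ge0 => //; last exact: integral_remainder_le.
  by move=> w; apply: sumr_ge0 => i _; rewrite addr_ge0// qpow_ge0.
by apply: measure_fin_exists_le => // e; exact: prob_sum_sin_gt.
Qed.

End disjoint_sums.

(** * Passage to overlapping sets through common atoms *)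

Section refinement.
Context {R : realType} {d dT : measure_display}
  {Omega : measurableType d} {T : measurableType dT}.
Variables (P : probability Omega R) (alpha : R).
Variables (Delta : {measure set T -> \bar R}) (M : set T -> Omega -> R[i]).
Hypothesis alpha_gt0 : 0 < alpha.
Hypothesis alpha_lt2 : alpha < 2.
Hypothesis rsmM : rot_inv_stable_random_measure P alpha Delta M.

Lemma normc_ge0 (z : R[i]) : 0 <= Normc.normc z.
Proof. by rewrite normc_sqrtE sqrtr_ge0. Qed.

Lemma rsm_set0 : {ae P, forall w, M set0 w = 0}.
Proof.
have := @rsm_sigma_additive _ _ _ _ _ _ _ _ _ rsmM (fun=> set0).
move=> /(_ (fun=> measurable0) (@trivIset_set0 _ _ _)).
rewrite bigcup_const// measure0 => /(_ (ltry _)).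
apply: filterS => w Mw.
apply: Normc.eq0_normc; apply/eqP; apply: contraT => z0.
have zgt0 : 0 < Normc.normc (M set0 w) by rewrite lt_neqAle eq_sym z0 normc_ge0.
(* The sequence of empty sets has partial sums [n * M set0], converging to [M set0]. At index
   [n + 2] the difference has modulus [(n + 1) |M set0| >= |M set0|], so it cannot be below
   [|M set0|]. *)
have /cvgrPdist_lt/(_ _ zgt0)[n _ /(_ n.+2 (leqW (leqnSn n)))] := Mw.
rewrite sub0r normrN ger0_norm ?normc_ge0//.
rewrite sumr_const card_ord mulrSr addrK normcMn.
by rewrite ltNge mulrS lerDl mulrn_wge0// normc_ge0.
Qed.

Lemma rsm_finite_additive (I : finType) (A : I -> set T) :
  (forall i, measurable (A i)) -> trivIset setT A ->
  (Delta (\bigcup_i A i) < +oo)%E ->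
  {ae P, forall w, M (\bigcup_i A i) w = \sum_i M (A i) w}.
Proof.
move=> mA tA fU.
(* The family is padded with empty sets, on which [M] vanishes almost surely; the partial sums are
   then stationary from [#|I|] on. *)
pose F (n : nat) : set T :=
  if insub n is Some k then A (enum_val (k : 'I_#|I|)) else set0.
have FE (k : 'I_#|I|) : F k = A (enum_val k) by rewrite /F valK.
have F0 n : (#|I| <= n)%N -> F n = set0.
  by move=> In; rewrite /F insubN// -leqNgt.
have mF n : measurable (F n).
  by rewrite /F; case: insubP => [k _ _|_].
have tF : trivIset setT F.
  apply/trivIsetP => m n _ _ mn; rewrite /F.
  case: insubP => [k _ km|_]; last by rewrite set0I.
  case: insubP => [l _ ln|_]; last by rewrite setI0.
  move/trivIsetP : tA; apply => //; apply: contra mn => /eqP/enum_val_inj kl.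
  by rewrite -km -ln kl.
have UF : \bigcup_n F n = \bigcup_i A i.
  apply/seteqP; split => x.
    move=> [n _]; rewrite /F; case: insubP => [k _ _ Ax|//].
    by exists (enum_val k).
  by move=> [i _ Aix]; exists (enum_rank i) => //; rewrite FE enum_rankK.
rewrite -UF in fU *.
have := rsm_sigma_additive rsmM mF tF fU; apply: filterS2 rsm_set0 => w M0 Mw.
have sE n : \sum_(k < #|I| + n) M (F k) w = \sum_i M (A i) w.
  rewrite big_split_ord/= [X in _ + X]big1 ?addr0.
    rewrite (big_enum_val (fun i => M (A i) w)).
    by apply: eq_bigr => k _; rewrite FE.
  by move=> k _; rewrite F0 ?M0// leq_addr.
apply/esym/eqP; rewrite -subr_eq0; apply/eqP.
apply: Normc.eq0_normc; apply/eqP; apply: contraT => z0.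
have zgt0 : 0 < Normc.normc (\sum_i M (A i) w - M (\bigcup_n F n) w).
  by rewrite lt_neqAle eq_sym z0 normc_ge0.
have /cvgrPdist_lt/(_ _ zgt0)[n _ /(_ (#|I| + n)%N (leq_addl _ _))] := Mw.
by rewrite sub0r normrN ger0_norm ?normc_ge0// sE ltxx.
Qed.

Variables (K E : finType) (B : K -> set T) (c : E -> K -> R[i]).
Hypothesis finB : forall k, finite_measure_set Delta (B k).

(* The pattern without any [k] is discarded: its atom may have infinite mass. *)
Let atom (J : {ffun K -> bool}) : set T :=
  [set x | (exists k, J k) /\ forall k, J k = `[< B k x >]].

Let measurable_atom J : measurable (atom J).
Proof.
have [[k Jk]|nJ] := pselect (exists k, J k); last first.
  by rewrite (_ : atom J = set0)//; apply/seteqP; split => // x [].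
rewrite (_ : atom J = \bigcap_k (if J k then B k else ~` B k)).
  apply: fin_bigcap_measurable; first exact: finite_finset.
  move=> l _; have [mB _] := finB l.
  by case: ifP => // _; exact: measurableC.
apply/seteqP; split => x /=.
  move=> [_ Jx] l _; rewrite Jx; by case: asboolP.
move=> Jx; split; first by exists k.
by move=> l; have := Jx l Logic.I; case: (J l) => /= Bl;
  [rewrite asboolT|rewrite asboolF].
Qed.

Let triv_atom : trivIset setT atom.
Proof.
apply/trivIsetP => J1 J2 _ _ J12; apply/seteqP; split => // x [[_ h1] [_ h2]].
move/eqP : J12; apply; apply/ffunP => k.
by rewrite h1 h2.
Qed.

Let atom_sub (J : {ffun K -> bool}) (k : K) : J k -> atom J `<=` B k.
Proof. by move=> Jk x [_ /(_ k)]; rewrite Jk => /esym/asboolP. Qed.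

Let finite_atom J : finite_measure_set Delta (atom J).
Proof.
split; first exact: measurable_atom.
have [[k Jk]|nJ] := pselect (exists k, J k); last first.
  by rewrite (_ : atom J = set0) ?measure0//; apply/seteqP; split => // x [].
have [mB fB] := finB k.
apply: le_lt_trans fB; apply: le_measure; rewrite ?inE//; exact: atom_sub.
Qed.

Let M_atoms : {ae P, forall w, forall k, M (B k) w =
  \sum_(J : {ffun K -> bool} | J k) M (atom J) w}.
Proof.
have one k : {ae P, forall w, M (B k) w =
    \sum_(J : {ffun K -> bool} | J k) M (atom J) w}.
  pose A (J : {ffun K -> bool}) := if J k then atom J else set0.
  have mA J : measurable (A J) by rewrite /A; case: ifP.
  have tA : trivIset setT A.
    apply/trivIsetP => J1 J2 _ _ J12; rewrite /A.
    case: ifP => _; last by rewrite set0I.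
    case: ifP => _; last by rewrite setI0.
    by move/trivIsetP : triv_atom; apply.
  have UA : \bigcup_J A J = B k.
    apply/seteqP; split => x.
      by move=> [J _]; rewrite /A; case: ifP => // Jk; exact: atom_sub.
    move=> Bx; exists [ffun k => `[< B k x >]] => //.
    rewrite /A ffunE asboolT//; split=> [|l]; last by rewrite ffunE.
    by exists k; rewrite ffunE asboolT.
  have fU : (Delta (\bigcup_J A J) < +oo)%E by rewrite UA; have [] := finB k.
  have := rsm_finite_additive mA tA fU.
  rewrite UA; apply: filterS2 rsm_set0 => w M0 ->.
  rewrite [RHS]big_mkcond; apply: eq_bigr => J _; rewrite /A.
  by case: ifP.
by apply: filter_forall.
Qed.

Lemma generalized_maximal_inequality (h : T -> R) (L q lam : R) :
  measurable_fun setT h -> (forall x, 0 <= h x) ->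
  (forall e x, Normc.normc (\sum_k c e k * (\1_(B k) x)%:C%C) `^ alpha <= h x) ->
  (\int[Delta]_x (h x)%:E <= L%:E)%E -> 1 <= q ->
  (P [set w | exists e, (2 * q `^ (2 / alpha) + lam <
      `|complex.Re (\sum_k c e k * M (B k) w)|)%R] <=
  (8 * qpow_const alpha * L / q + #|E|%:R * (2 * expR (4 * L - lam)))%:E)%E.
Proof.
move=> mh h0 hc hL q1.
pose c' e (J : {ffun K -> bool}) := \sum_(k | J k) c e k.
pose D (J : {ffun K -> bool}) := \big[Order.max/0]_e Normc.normc (c' e J).
have D0 J : 0 <= D J by exact: bigmax_ge_id.
have cD e J : Normc.normc (c' e J) <= D J by exact: le_bigmax.
have DL : \sum_J stable_scale alpha Delta (atom J) (D J) <= L.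
  rewrite -lee_fin; apply: le_trans hL.
  rewrite -sumEFin.
  rewrite (eq_bigr (fun J => \int[Delta]_x (D J `^ alpha * \1_(atom J) x)%:E)%E);
    last first.
    move=> J _; have [mJ fJ] := finite_atom J.
    under eq_integral do rewrite EFinM.
    rewrite ge0_integralZl_EFin ?powR_ge0//; last 1 first.
      by apply/measurable_EFinP.
    rewrite integral_indic// setIT /stable_scale mulrC EFinM fineK//.
    by rewrite ge0_fin_numE.
  rewrite -ge0_integral_sum//; last 2 first.
  - by move=> J; apply/measurable_EFinP; apply: measurable_funM.
  - by move=> J x _; rewrite lee_fin mulr_ge0 ?powR_ge0.
  apply: ge0_le_integral => //.
  - by move=> x _; apply: sume_ge0 => J _; rewrite lee_fin mulr_ge0 ?powR_ge0.
  - apply: emeasurable_sum => J; apply/measurable_EFinP; exact: measurable_funM.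
  - by apply/measurable_EFinP.
  move=> x _; rewrite sumEFin lee_fin.
  (* The membership pattern of [x]: only the atom of [J0] can contain [x], so one term of the sum
     survives at most. *)
  pose J0 : {ffun K -> bool} := [ffun k => `[< B k x >]].
  rewrite (bigD1 J0)//= big1 ?addr0; last first.
    move=> J JJ0; rewrite indicE memNset ?mulr0// => -[_ Jx].
    by move/eqP : JJ0; apply; apply/ffunP => k; rewrite ffunE.
  have [xJ|xJ] := pselect (atom J0 x); last by rewrite indicE memNset// mulr0.
  rewrite indicE mem_set// mulr1 /D.
  have hm e : Normc.normc (c' e J0) `^ alpha <= h x.
    apply: le_trans (hc e x); rewrite le_eqVlt; apply/orP; left; apply/eqP.
    congr (Normc.normc _ `^ _); rewrite /c' big_mkcond; apply: eq_bigr => k _.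
    rewrite ffunE indicE; case: asboolP => Bk.
      by rewrite mem_set// mulr1.
    by rewrite memNset// mulr0.
  apply: (big_ind (fun y => y `^ alpha <= h x)) => //.
    by rewrite powR0 ?gt_eqF.
  by move=> y z hy hz; rewrite /Order.max; case: ifP.
have main := disjoint_maximal_inequality alpha_gt0 alpha_lt2 rsmM finite_atom
  triv_atom D0 cD DL lam q1.
(* The decomposition of [M (B k)] over atoms fails on a null set, which is added to the event at no
   cost. *)
have [N [mN PN0 sub]] := M_atoms.
have mev (I : finType) (A : I -> set T) (a : E -> I -> R[i]) :
    (forall i, finite_measure_set Delta (A i)) ->
    measurable [set w | exists e, (2 * q `^ (2 / alpha) + lam <
      `|complex.Re (\sum_k a e k * M (A k) w)|)%R].
  move=> fA; apply: measurable_fin_exists => e; apply: measurable_gt_cst.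
  apply: measurableT_comp => //.
  rewrite (_ : (fun w => _) = fun w => \sum_i lin_re_im (complex.Re (a e i))
      (- complex.Im (a e i)) (M (A i) w)).
    by apply: measurable_sum => i; exact: (measurable_lin_re_im rsmM).
  apply/funext => w; rewrite raddf_sum; apply: eq_bigr => i _; exact: Re_mulE.
apply: le_trans main.
rewrite -[leRHS]adde0 -PN0.
apply: le_trans (measureU2 _ (mev _ _ _ finite_atom) mN).
apply: le_measure; rewrite ?inE//; [exact: mev|by apply: measurableU => //;
  exact: mev|].
move=> w /= [e he]; have [wN|wN] := pselect (N w); [by right|left; exists e].
have Mw : forall k, M (B k) w = \sum_(J : {ffun K -> bool} | J k) M (atom J) w.
  by apply: contrapT => Mw; apply: wN; exact: sub.
rewrite (_ : \sum_J _ = \sum_k c e k * M (B k) w)//.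
under [RHS]eq_bigr do rewrite Mw big_mkcond mulr_sumr.
rewrite exchange_big/=; apply: eq_bigr => J _.
rewrite /c' mulr_suml [LHS]big_mkcond; apply: eq_bigr => k _.
by case: ifP; rewrite ?mulr0.
Qed.

End refinement.

(** * Maximal inequality for increments of stochastic integrals *)

Section stochastic_integral_maximal.
Context {R : realType} {d dT : measure_display}
  {Omega : measurableType d} {T : measurableType dT}.
Variables (P : probability Omega R) (alpha : R).
Variables (Delta : {measure set T -> \bar R}) (M : set T -> Omega -> R[i]).
Hypothesis alpha_gt0 : 0 < alpha.
Hypothesis alpha_lt2 : alpha < 2.
Hypothesis rsmM : rot_inv_stable_random_measure P alpha Delta M.

Lemma normc_leD (x y : R[i]) :
  Normc.normc (x + y) <= Normc.normc x + Normc.normc y.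
Proof. exact: le_normcD. Qed.

Lemma normc_opp (x : R[i]) : Normc.normc (- x) = Normc.normc x.
Proof. exact: normcN. Qed.

Lemma cmeasurableB d' (S : measurableType d') (g1 g2 : S -> R[i]) :
  cmeasurable g1 -> cmeasurable g2 -> cmeasurable (fun x => g1 x - g2 x).
Proof.
move=> [r1 i1] [r2 i2]; split.
  rewrite (_ : (fun x => _) = (fun x => complex.Re (g1 x) - complex.Re (g2 x))).
    exact: measurable_funB.
  by apply/funext => x; rewrite raddfB.
rewrite (_ : (fun x => _) = (fun x => complex.Im (g1 x) - complex.Im (g2 x))).
  exact: measurable_funB.
by apply/funext => x; rewrite raddfB.
Qed.

Lemma measurable_normc d' (S : measurableType d') (g : S -> R[i]) :
  cmeasurable g -> measurable_fun setT (fun x => Normc.normc (g x)).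
Proof.
move=> [mr mi].
rewrite (_ : (fun x => _) = (fun x => Num.sqrt (complex.Re (g x) ^+ 2 +
  complex.Im (g x) ^+ 2))).
  apply: (measurableT_comp (@continuous_measurable_fun _ _ (@sqrt_continuous R))).
  by apply: measurable_funD; apply: measurable_funX.
by apply/funext => x; rewrite normc_sqrtE.
Qed.

Lemma cmeasurable_csum d' (S : measurableType d') n (a : 'I_n ->
  R[i]) (g : 'I_n -> S -> R[i]) :
  (forall j, cmeasurable (g j)) -> cmeasurable (fun x => \sum_(j < n) a j * g j x).
Proof.
move=> mg; split.
  rewrite (_ : (fun x => _) = (fun x => \sum_(j < n)
      (complex.Re (a j) * complex.Re (g j x) - complex.Im (a j) * complex.Im (g j
        x)))).
    apply: measurable_sum => j; have [mr mi] := mg j.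
    by apply: measurable_funB; apply: measurable_funM.
  apply/funext => x; rewrite raddf_sum; apply: eq_bigr => j _.
  by case: (a j) => u v; case: (g j x).
rewrite (_ : (fun x => _) = (fun x => \sum_(j < n)
    (complex.Re (a j) * complex.Im (g j x) + complex.Im (a j) * complex.Re (g j
      x)))).
  apply: measurable_sum => j; have [mr mi] := mg j.
  by apply: measurable_funD; apply: measurable_funM.
apply/funext => x; rewrite raddf_sum; apply: eq_bigr => j _.
by case: (a j) => u v; case: (g j x).
Qed.

Lemma cmeasurable_csimple_fun (s : csimple Delta) : cmeasurable (csimple_fun s).
Proof.
apply: cmeasurable_csum => j; split => /=.
  by have [mA _] := cs_finite j; exact: measurable_indic.
exact: measurable_cst.
Qed.

Lemma cmeasurable_csimple_integral (s : csimple Delta) :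
  cmeasurable (csimple_integral M s).
Proof.
by apply: cmeasurable_csum => j; apply: (rsm_measurable rsmM); exact: cs_finite.
Qed.

Variables (I E : finType) (g : I -> T -> R[i]) (Y : I -> Omega -> R[i]).
Variables (u v : E -> I) (phi : T -> R) (b : R).
Hypothesis b_gt0 : 0 < b.
Hypothesis gY : forall i, is_stochastic_integral P alpha Delta M (g i) (Y i).
Hypothesis mphi : measurable_fun setT phi.
Hypothesis phi_ge0 : forall x, 0 <= phi x.
Hypothesis g_phi : forall e x, Normc.normc (g (u e) x - g (v e) x) <= phi x.
Hypothesis phi_int : (\int[Delta]_x (phi x `^ alpha)%:E <= (b `^ alpha)%:E)%E.

(** Signed incidence matrix of the graph with edges from [v e] to [u e], normalized by [b] so that
    the scale of an edge becomes bounded by an absolute constant. *)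
Let sg (e : E) (i : I) : R[i] := (b^-1)%:C%C * ((i == u e)%:R - (i == v e)%:R).

Let sum_sg e (F : I -> R[i]) :
  \sum_i sg e i * F i = (b^-1)%:C%C * (F (u e) - F (v e)).
Proof.
under eq_bigr do rewrite /sg -mulrA mulrBl.
rewrite -mulr_sumr sumrB; congr (_ * (_ - _)).
  rewrite (bigD1 (u e))//= eqxx mul1r big1 ?addr0// => i /negbTE ->.
  by rewrite mul0r.
rewrite (bigD1 (v e))//= eqxx mul1r big1 ?addr0// => i /negbTE ->.
by rewrite mul0r.
Qed.

Lemma normcC (r : R) : 0 <= r -> Normc.normc r%:C%C = r.
Proof. by move=> r0; rewrite normc_sqrtE /= expr0n addr0 sqrtr_sqr ger0_norm. Qed.

(** The sum is at most 3 times the largest term, and [3^alpha <= 9]. *)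
Lemma powR_max3_le (x y z : R) : 0 <= x -> 0 <= y -> 0 <= z ->
  (x + y + z) `^ alpha <= 9 * (x `^ alpha + y `^ alpha + z `^ alpha).
Proof.
move=> x0 y0 z0.
have h (t : R) : 0 <= t -> x <= t -> y <= t -> z <= t ->
    (x + y + z) `^ alpha <= 9 * t `^ alpha.
  move=> t0 xt yt zt; apply: (@le_trans _ _ ((3 * t) `^ alpha)).
    rewrite ge0_ler_powR ?nnegrE ?(ltW alpha_gt0)// ?addr_ge0 ?mulr_ge0//; lra.
  rewrite powRM// ler_wpM2r ?powR_ge0//.
  apply: (@le_trans _ _ (3 `^ 2%:R)); first by rewrite ler_powR ?ler1n// ltW.
  by rewrite powR_mulrn// -natrX.
have hx := powR_ge0 x alpha; have hy := powR_ge0 y alpha;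
  have hz := powR_ge0 z alpha.
have [xy|/ltW yx] := leP x y; [have [yz|/ltW zy] := leP y z|have [xz|/ltW zx] :=
  leP x z].
- by apply: (le_trans (h z z0 _ _ _)) => //; [exact: le_trans yz|lra].
- by apply: (le_trans (h y y0 _ _ _)) => //; lra.
- by apply: (le_trans (h z z0 _ _ _)) => //; [exact: le_trans xz|lra].
- by apply: (le_trans (h x x0 _ _ _)) => //; lra.
Qed.

Let maximal_simple (s : I -> csimple Delta) (q lam : R) : 1 <= q ->
  (\sum_i \int[Delta]_x
      (Normc.normc (csimple_fun (s i) x - g i x) `^ alpha)%:E <=
    (b `^ alpha / 9)%:E)%E ->
  (P [set w | exists e, (2 * q `^ (2 / alpha) + lam <
     b^-1 * `|complex.Re (csimple_integral M (s (u e)) w -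
                          csimple_integral M (s (v e)) w)|)%R] <=
  (8 * qpow_const alpha * 10 / q + #|E|%:R * (2 * expR (40 - lam)))%:E)%E.
Proof.
move=> q1 serr.
(* All pieces of all the simple functions together; pieces belonging to different [i] may
   overlap. *)
pose K : finType := {i : I & 'I_(cs_size (s i))}.
pose B (k : K) : set T := @cs_set _ _ _ _ (s (tag k)) (tagged k).
pose c (e : E) (k : K) : R[i] := sg e (tag k) * @cs_coef _ _ _ _ (s (tag k))
  (tagged k).
have finB k : finite_measure_set Delta (B k) by exact: cs_finite.
have sumK e (F : set T -> R[i]) : \sum_k c e k * F (B k) = (b^-1)%:C%C *
    (\sum_(j < cs_size (s (u e))) cs_coef j * F (cs_set j) -
     \sum_(j < cs_size (s (v e))) cs_coef j * F (cs_set j)).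
  rewrite -(sum_sg e (fun i => \sum_(j < cs_size (s i)) cs_coef j * F (cs_set j))).
  under [RHS]eq_bigr do rewrite mulr_sumr.
  rewrite sig_big_dep; apply: eq_bigr => -[i j] _.
  by rewrite /c /B /= mulrA.
pose err i x := Normc.normc (csimple_fun (s i) x - g i x).
have merr i : measurable_fun setT (fun x => err i x `^ alpha).
  apply: (measurableT_comp (measurable_powR alpha)); apply: measurable_normc.
  by apply: cmeasurableB; [exact: cmeasurable_csimple_fun|have [] := gY i].
have mpa : measurable_fun setT (fun x => phi x `^ alpha).
  exact: (measurableT_comp (measurable_powR alpha)).
have mse : measurable_fun setT (fun x => \sum_i err i x `^ alpha).
  exact: measurable_sum.
have ba : 0 < b `^ alpha by exact: powR_gt0.
(* The common majorant: kernel bound plus all approximation errors. Its integral is at most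
   [9 + 1 = 10], whence the constants [80 = 8 * 10] and [40 = 4 * 10]. *)
pose h x := 9 / b `^ alpha * (phi x `^ alpha + \sum_i err i x `^ alpha).
have se0 x : 0 <= \sum_i err i x `^ alpha by apply: sumr_ge0 => i _;
  exact: powR_ge0.
have mh : measurable_fun setT h.
  by apply: measurable_funM => //; exact: measurable_funD.
have h0 x : 0 <= h x by rewrite mulr_ge0 ?addr_ge0 ?powR_ge0// divr_ge0// ltW.
have hc e x : Normc.normc (\sum_k c e k * (\1_(B k) x)%:C%C) `^ alpha <= h x.
  rewrite (sumK e (fun A => (\1_A x)%:C%C)).
  rewrite -/(csimple_fun (s (u e)) x) -/(csimple_fun (s (v e)) x).
  rewrite Normc.normcM normcC ?invr_ge0 ?(ltW b_gt0)//.
  rewrite powRM ?invr_ge0 ?normc_ge0 ?(ltW b_gt0)//.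
  have -> : b^-1 `^ alpha = (b `^ alpha)^-1.
    by rewrite -powR_inv1 ?(ltW b_gt0)// -powRrM mulN1r powRN.
  rewrite /h (mulrC 9) -mulrA ler_pM2l ?invr_gt0//.
  (* A loop would need the same error term twice, while the sum over [i] contains it once; its
     increment vanishes anyway. *)
  have [uv|uv] := eqVneq (u e) (v e).
    rewrite uv subrr Normc.normc0 powR0 ?gt_eqF// mulr_ge0// addr_ge0// powR_ge0//.
  apply: (@le_trans _ _ ((phi x + err (u e) x + err (v e) x) `^ alpha)).
    rewrite ge0_ler_powR ?nnegrE ?normc_ge0 ?addr_ge0 ?normc_ge0 ?(ltW alpha_gt0)//.
    have -> : csimple_fun (s (u e)) x - csimple_fun (s (v e)) x =
       (g (u e) x - g (v e) x) + (csimple_fun (s (u e)) x - g (u e) x) +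
       - (csimple_fun (s (v e)) x - g (v e) x).
      by ring.
    apply: (le_trans (normc_leD _ _)); rewrite normc_opp lerD2r.
    apply: (le_trans (normc_leD _ _)); rewrite lerD2r.
    exact: g_phi.
  apply: (le_trans (powR_max3_le _ _ _)); rewrite ?normc_ge0//.
  rewrite ler_pM2l// -addrA lerD2l (bigD1 (u e))//= lerD2l (bigD1 (v e)) ?(eq_sym
    (v e))//=.
  by rewrite lerDl; apply: sumr_ge0 => i _; exact: powR_ge0.
have hint : (\int[Delta]_x (h x)%:E <= 10%:E)%E.
  rewrite /h; under eq_integral do rewrite EFinM.
  rewrite ge0_integralZl_EFin//; last 3 first.
  - by move=> x _; rewrite lee_fin addr_ge0// powR_ge0.
  - by apply/measurable_EFinP; exact: measurable_funD.
  - by rewrite divr_ge0// ltW.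
  under eq_integral do rewrite EFinD.
  rewrite ge0_integralD//; last 4 first.
  - by move=> x _; rewrite lee_fin powR_ge0.
  - exact/measurable_EFinP.
  - by move=> x _; rewrite lee_fin.
  - exact/measurable_EFinP.
  under [X in (_ * (_ + X))%E]eq_integral do rewrite -sumEFin.
  rewrite ge0_integral_sum//; last 2 first.
  - by move=> i; exact/measurable_EFinP.
  - by move=> i x _; rewrite lee_fin powR_ge0.
  apply: (@le_trans _ _ ((9 / b `^ alpha)%:E * ((b `^ alpha)%:E + (b `^ alpha /
    9)%:E))%E).
    by rewrite lee_wpmul2l ?lee_fin ?divr_ge0 ?(ltW ba)//; exact: leeD.
  rewrite -EFinD -EFinM lee_fin le_eqVlt; apply/orP; left; apply/eqP.
  by field; rewrite gt_eqF.
have := @generalized_maximal_inequality _ _ _ _ _ P alpha Delta M alpha_gt0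
  alpha_lt2 rsmM K E B c finB h 10 q lam mh h0 hc hint q1.
rewrite -natrM /=; congr (P _ <= _)%E.
apply/seteqP; split => w /= [e he]; exists e; move: he.
all: rewrite (sumK e (fun A => M A w)).
all: set z := (_ - _) => /=.
all: have -> : complex.Re ((b^-1)%:C%C * z) = b^-1 * complex.Re z
  by case: z => z1 z2 /=; rewrite mul0r subr0.
all: by rewrite normrM (@ger0_norm _ b^-1)// invr_ge0 ltW.
Qed.

Lemma stochastic_integral_maximal_inequality (q lam : R) : 1 <= q ->
  (P [set w | exists e, (b * (2 * q `^ (2 / alpha) + lam + 1) <
     `|complex.Re (Y (u e) w) - complex.Re (Y (v e) w)|)%R] <=
  (80 * qpow_const alpha / q + #|E|%:R * (2 * expR (40 - lam)))%:E)%E.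
Proof.
move=> q1.
have /choice[s sP] : forall i, exists s : (csimple Delta)^nat,
    (\int[Delta]_x (Normc.normc (csimple_fun (s n) x - g i x) `^ alpha)%:E)%E
        @[n --> \oo] --> 0%E /\
    forall e : R, 0 < e ->
        P [set w | e <= Normc.normc (csimple_integral M (s n) w - Y i w)]
          @[n --> \oo] --> 0%E.
  by move=> i; have [_ _ [s sP]] := gY i; exists s.
apply/lee_addgt0Pr => del del0.
(* The tolerances are shared among the points. Since [I] is finite, one index [n] achieves them all,
   and the added 1 keeps [m] positive when [I] is empty. *)
pose m : R := #|I|%:R + 1.
have m0 : 0 < m by rewrite ltr_wpDl.
have ba : 0 < b `^ alpha by exact: powR_gt0.
have b20 : 0 < b / 2 by rewrite divr_gt0.
have [n [nerr nprob]] : exists n, (forall i, \int[Delta]_x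
     (Normc.normc (csimple_fun (s i n) x - g i x) `^ alpha)%:E <= (b `^ alpha / 9
       / m)%:E)%E /\
   (forall i, P [set w | (b / 2 <= Normc.normc (csimple_integral M (s i n) w - Y
     i w))%R] <=
     (del / m)%:E)%E.
  have nr (f : nat -> I -> \bar R) (t : R) : 0 < t ->
      (forall i, f n i @[n --> \oo] --> 0%E) ->
      \forall n \near \oo, forall i, (f n i <= t%:E)%E.
    move=> t0 fi; apply: filter_forall => i.
    have t0' : (0 < t%:E)%E by rewrite lte_fin.
    have H : \forall n \near \oo, (f n i < t%:E)%E := fi i _ (open_ereal_lt' t0').
    by move: H; apply: filterS => n; exact: ltW.
  have ba9 : 0 < b `^ alpha / 9 / m by rewrite !divr_gt0.
  have dm : 0 < del / m by rewrite divr_gt0.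
  have n1 := nr _ _ ba9 (fun i => (sP i).1).
  have n2 := nr _ _ dm (fun i => (sP i).2 _ b20).
  have [n _ /(_ n (leqnn n))[]] := filterI n1 n2.
  by exists n.
have Im t : 0 < t -> #|I|%:R * (t / m) <= t.
  move=> t0; rewrite mulrCA -[leRHS]mulr1 ler_pM2l// ler_pdivrMr// mul1r.
  by rewrite /m lerDl.
have serr : (\sum_i \int[Delta]_x
      (Normc.normc (csimple_fun (s i n) x - g i x) `^ alpha)%:E <=
    (b `^ alpha / 9)%:E)%E.
  apply: (@le_trans _ _ (\sum_(i : I) (b `^ alpha / 9 / m)%:E)%E).
    by apply: lee_sum.
  rewrite sumEFin lee_fin sumr_const -[leLHS]mulr_natl Im//.
  by rewrite divr_gt0.
have := maximal_simple (s := s^~ n) lam q1 serr.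
set ev := [set w | exists e, _] => hev.
set ev' := [set w | exists e, _].
pose bad := [set w | exists i, (b / 2 <= Normc.normc (csimple_integral M (s i n)
  w - Y i w))%R].
have mYi i : measurable_fun setT (fun w => complex.Re (Y i w)).
  by have [_ [mr _] _] := gY i.
have mSi i : measurable_fun setT (fun w => complex.Re (csimple_integral M (s i n)
  w)).
  by have [mr _] := cmeasurable_csimple_integral (s i n).
have mbadi i : measurable [set w | (b / 2 <= Normc.normc (csimple_integral M (s i
  n) w - Y i w))%R].
  apply: measurable_ge_cst; apply: measurable_normc; apply: cmeasurableB.
    exact: cmeasurable_csimple_integral.
  by have [_ mY _] := gY i.
have mbad : measurable bad by exact: measurable_fin_exists.
have mev : measurable ev.
  apply: measurable_fin_exists => e; apply: measurable_gt_cst.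
  apply: measurable_funM => //; apply: measurableT_comp => //.
  have [mr _] := cmeasurableB (cmeasurable_csimple_integral (s (u e) n))
    (cmeasurable_csimple_integral (s (v e) n)).
  exact: mr.
have mev' : measurable ev'.
  apply: measurable_fin_exists => e; apply: measurable_gt_cst.
  by apply: measurableT_comp => //; exact: measurable_funB.
apply: (@le_trans _ _ (P (ev `|` bad))).
  apply: le_measure; rewrite ?inE//; first exact: measurableU.
  move=> w [e he]; have [wb|wb] := pselect (bad w); [by right|left; exists e].
  (* Outside [bad] each endpoint costs less than [b / 2], so an increment changes by less than [b]:
     this is the [+ 1] in the threshold. The probability of [bad] is at most the arbitrary [del]. *)
  have nb i : Normc.normc (csimple_integral M (s i n) w - Y i w) < b / 2.
    by rewrite ltNge; apply/negP => h; apply: wb; exists i.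
  have nbRe i : `|complex.Re (csimple_integral M (s i n) w) - complex.Re (Y i w)|
    < b / 2.
    by rewrite -raddfB; apply: le_lt_trans (normr_Re_le _) (nb i).
  have h1 := nbRe (u e); have h2 := nbRe (v e).
  rewrite raddfB /=.
  set S1 := complex.Re (csimple_integral M (s (u e) n) w) in h1 *.
  set S2 := complex.Re (csimple_integral M (s (v e) n) w) in h2 *.
  set Y1 := complex.Re (Y (u e) w) in h1 he *.
  set Y2 := complex.Re (Y (v e) w) in h2 he *.
  rewrite -(ltr_pM2l b_gt0) mulrA mulfV ?gt_eqF// mul1r.
  have h3 : `|Y1 - Y2| <= `|S1 - S2| + `|S1 - Y1| + `|S2 - Y2|.
    have -> : Y1 - Y2 = (S1 - S2) - (S1 - Y1) + (S2 - Y2) by ring.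
    rewrite (le_trans (ler_normD _ _))// lerD2r.
    by rewrite (le_trans (ler_normD _ _))// normrN.
  rewrite mulrDr mulr1 in he; lra.
apply: (le_trans (measureU2 _ mev mbad)).
apply: leeD.
  rewrite (_ : 80 * qpow_const alpha / q = 8 * qpow_const alpha * 10 / q)//.
  by ring.
apply: (le_trans (measure_fin_exists_le mbadi nprob)).
by rewrite lee_fin Im.
Qed.

End stochastic_integral_maximal.

(** * Spectral integrals *)

Lemma pow1R (R : realType) (a : R) : 1 `^ a = 1.
Proof. by rewrite powR1. Qed.

Lemma powR_le (R : realType) (a x y : R) : 0 <= a -> 0 <= x -> x <= y ->
  x `^ a <= y `^ a.
Proof.
by move=> a0 x0 xy; rewrite ge0_ler_powR ?nnegrE// (le_trans x0).
Qed.

Section two_sided_geometric.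
Context {R : realType}.

(** Subtraction is truncated, so for each [i] one of the two powers is 1: the terms decay with ratio
    [r] below [n] and with ratio [s] above. *)
Lemma nneseries_two_sided_geometric (r s : R) (n : nat) :
  0 <= r -> r < 1 -> 0 <= s -> s < 1 ->
  (\sum_(i <oo) (r ^+ (n - i) * s ^+ (i - n))%:E <=
   ((1 - r)^-1 + (1 - s)^-1)%:E)%E.
Proof.
move=> r0 r1 s0 s1.
have t0 m i : (0 <= (r ^+ (m - i) * s ^+ (i - m))%:E)%E.
  by rewrite lee_fin mulr_ge0// exprn_ge0.
(* The finite geometric sum makes induction on [n] possible: removing the term [i = 0] and shifting
   turns level [n + 1] into level [n]. *)
suff : (\sum_(i <oo) (r ^+ (n - i) * s ^+ (i - n))%:E <=
   ((1 - r ^+ n.+1) / (1 - r) + (1 - s)^-1)%:E)%E.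
  move/le_trans; apply; rewrite lee_fin lerD2r ler_pdivrMr ?subr_gt0//.
  by rewrite mulVf ?gt_eqF ?subr_gt0// lerBlDr lerDl exprn_ge0.
elim: n => [|n IH].
  under eq_eseriesr do rewrite sub0n subn0 expr0.
  rewrite nneseries_geometric ?ger0_norm// lee_fin mul1r expr1.
  by rewrite mulfV ?gt_eqF ?subr_gt0// lerDr.
rewrite nneseries_recl//= subn0 sub0n expr0 mulr1.
rewrite -nneseries_addn//.
rewrite (eq_eseriesr (g := fun i => (r ^+ (n - i) * s ^+ (i - n))%:E)); last first.
  by move=> i _; rewrite addn1 !subSS.
apply: (le_trans (leeD2l _ IH)); rewrite -EFinD lee_fin addrA lerD2r.
rewrite le_eqVlt; apply/orP; left; apply/eqP.
have r1' : 1 - r != 0 by rewrite subr_eq0 eq_sym lt_eqF.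
apply: (mulIf r1'); rewrite mulrDl !divfK// (exprS r n.+1); ring.
Qed.

End two_sided_geometric.

Section euclidean_norm.
Context {R : realType} {N : nat}.
Implicit Types x : 'rV[R]_N.

Lemma enorm_ge0 x : 0 <= enorm x.
Proof. exact: sqrtr_ge0. Qed.

Lemma coord_le_enorm x i : `|x ord0 i| <= enorm x.
Proof.
rewrite /enorm -sqrtr_sqr ler_wsqrtr// /inner (bigD1 i)//= -expr2 lerDl.
by apply: sumr_ge0 => j _; rewrite -expr2 sqr_ge0.
Qed.

Lemma measurable_enorm : measurable_fun setT (@enorm R N).
Proof.
apply: (measurableT_comp (@continuous_measurable_fun _ _ (@sqrt_continuous R))).
by apply: measurable_sum => i; apply: measurable_funM; exact: measurable_coord.
Qed.

Lemma lebesgue_row_cube (r : R) : 0 < r ->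
  lebesgue_row N [set x : 'rV[R]_N | forall i, x ord0 i \in `[- r, r]] =
  ((2 * r) ^+ N)%:E.
Proof.
move=> r0.
have := @lebesgue_row_box R N (fun=> `[- r, r]%classic) (fun=> measurable_itv _).
move=> ->; rewrite /lebesgue_line lebesgue_measure_itv /= lte_fin gtrN//.
rewrite -EFinB prodEFin prodr_const card_ord; congr (_ ^+ _)%:E; ring.
Qed.

End euclidean_norm.

Section spectral.
Context {R : realType} {N : nat}.
Variables (alpha H K11 K12 : R) (Delta : {measure set 'rV[R]_N -> \bar R})
  (f : 'rV[R]_N -> R).
Hypotheses (alpha_gt0 : 0 < alpha) (H_gt0 : 0 < H) (H_lt1 : H < 1)
  (K11_gt0 : 0 < K11) (K12_gt0 : 0 < K12).
Hypothesis Delta_int :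
  (\int[Delta]_x (Num.min 1 (enorm x `^ alpha))%:E < +oo)%E.
Hypotheses (mf : measurable_fun setT f) (f_ge0 : forall x, 0 <= f x).
Hypothesis DeltaE : forall A, measurable A ->
  Delta A = (\int[lebesgue_row N]_(x in A) (f x)%:E)%E.
Hypothesis f_le : forall x, K12 <= enorm x ->
  f x <= K11 * enorm x `^ (- (alpha * H + N%:R)).

Let shell (i : nat) : set 'rV[R]_N :=
  [set x | 2 ^+ i <= enorm x /\ enorm x < 2 ^+ i.+1].

Let measurable_shell i : measurable (shell i).
Proof.
rewrite (_ : shell i = [set x | 2 ^+ i <= enorm x] `&` ~` [set x | 2 ^+ i.+1 <=
  enorm x]).
  apply: measurableI; first exact: (measurable_ge_cst _ measurable_enorm).
  by apply: measurableC; exact: (measurable_ge_cst _ measurable_enorm).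
apply/seteqP; split => x /= [h1 h2]; split => //.
  by apply/negP; rewrite -ltNge.
by rewrite ltNge; apply/negP.
Qed.

(** The shell lies in a cube of side [4 * 2^i]; its volume [4^N 2^(i N)] cancels the [N] in the
    decay exponent of the density. *)
Lemma shell_mass_le i : K12 <= 2 ^+ i ->
  (Delta (shell i) <= (K11 * 4 ^+ N * (2 ^+ i) `^ (- (alpha * H)))%:E)%E.
Proof.
move=> Ki; rewrite DeltaE//.
have p0 : 0 < 2 ^+ i :> R by rewrite exprn_gt0.
pose c := K11 * (2 ^+ i) `^ (- (alpha * H + N%:R)).
have c0 : 0 <= c by rewrite mulr_ge0 ?powR_ge0// ltW.
pose cube := [set x : 'rV[R]_N | forall j, x ord0 j \in `[- 2 ^+ i.+1, 2 ^+ i.+1]].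
have mcube : measurable cube.
  rewrite (_ : cube = \bigcap_j ((fun v : 'rV[R]_N =>
    v ord0 j) @^-1` `[- 2 ^+ i.+1, 2 ^+ i.+1])).
    apply: fin_bigcap_measurable; first exact: finite_finset.
    by move=> j _; rewrite -[X in measurable X]setTI; exact: measurable_coord.
  by apply/seteqP; split => x /= h j; [move=> _|]; exact: h.
apply: (@le_trans _ _ (\int[lebesgue_row N]_(x in shell i) (cst c%:E x))%E).
  apply: ge0_le_integral => //.
  - by move=> x _; rewrite lee_fin.
  - by apply/measurable_EFinP; exact: measurable_funS mf.
  - move=> x [h1 h2]; rewrite lee_fin.
    apply: (le_trans (f_le (le_trans Ki h1))).
    rewrite ler_wpM2l ?(ltW K11_gt0)// !powRN lef_pV2 ?posrE ?powR_gt0//;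
      last first.
      exact: lt_le_trans h1.
    by apply: powR_le; [rewrite addr_ge0// mulr_ge0// ltW|exact: ltW|].
rewrite integral_cst//.
apply: (@le_trans _ _ (c%:E * lebesgue_row N cube)%E).
  rewrite lee_wpmul2l// ?lee_fin//; apply: le_measure; rewrite ?inE//.
  move=> x [_ h] j; rewrite in_itv/= -ler_norml.
  exact: le_trans (coord_le_enorm x j) (ltW h).
rewrite lebesgue_row_cube ?exprn_gt0// -EFinM lee_fin /c.
rewrite opprD powRD; last by rewrite (gt_eqF p0) implybT.
rewrite (powRN _ N%:R) powR_mulrn ?(ltW p0)//.
have -> : 2 * 2 ^+ i.+1 = 4 * 2 ^+ i :> R by rewrite exprS; ring.
rewrite exprMn.
set a := powR _ _; set b := (2 ^+ i) ^+ N.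
have b0 : b != 0 by rewrite expf_neq0// gt_eqF.
rewrite le_eqVlt; apply/orP; left; apply/eqP.
by field.
Qed.

(** Relative to [2^(- n alpha H)], the shells outside radius [2^n] decay with ratio [2^(- alpha H)],
    those inside with ratio [2^(- alpha (1 - H))]. Summability on the two sides is where [0 < H] and
    [H < 1] enter. *)
Lemma shell_weight_le (n i : nat) :
  Num.min 1 (2 ^+ i / 2 ^+ n) `^ alpha * (2 ^+ i) `^ (- (alpha * H)) <=
  (2 ^+ n) `^ (- (alpha * H)) *
  ((2 `^ (- (alpha * (1 - H)))) ^+ (n - i) * (2 `^ (- (alpha * H))) ^+ (i - n))
    :> R.
Proof.
have p0 k : 0 < 2 ^+ k :> R by rewrite exprn_gt0.
have e (a : R) k : (2 `^ a) ^+ k = (2 ^+ k) `^ a.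
  rewrite -(powR_mulrn k (powR_ge0 2 a)) -(powR_mulrn k (ler0n R 2)).
  by rewrite -!powRrM mulrC.
rewrite !e.
have [ni|/ltnW ni] := leqP n i.
  have -> : (n - i = 0)%N by apply/eqP; rewrite subn_eq0.
  rewrite expr0 powR1 mul1r.
  rewrite -{2}(subnKC ni) exprD powRM ?(ltW (p0 _))//.
  rewrite -[leRHS]mul1r ler_wpM2r ?mulr_ge0 ?powR_ge0//.
  rewrite -[leRHS](pow1R alpha); apply: powR_le; first exact: ltW.
    by rewrite le_min ler01 divr_ge0// ltW.
  by rewrite ge_min lexx.
have -> : (i - n = 0)%N by apply/eqP; rewrite subn_eq0.
rewrite expr0 powR1 mulr1 -{1 2}(subnKC ni) exprD.
rewrite (powRM _ (ltW (p0 i)) (ltW (p0 (n - i)%N))).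
set m := (n - i)%N.
apply: (@le_trans _ _ ((2 ^+ m)^-1 `^ alpha * (2 ^+ i) `^ (- (alpha * H)))).
  rewrite ler_wpM2r ?powR_ge0//; apply: powR_le; first exact: ltW.
  - by rewrite le_min ler01 divr_ge0 ?mulr_ge0// ltW.
  - by rewrite ge_min invfM mulrA divff ?gt_eqF// mul1r lexx orbT.
rewrite mulrC -mulrA ler_wpM2l ?powR_ge0// -powRD;
  last by rewrite (gt_eqF (p0 m)) implybT.
have -> : (2 ^+ m)^-1 = (2 ^+ m) `^ (- 1) :> R by rewrite powR_inv1// ltW.
by rewrite -powRrM le_eqVlt; apply/orP; left; apply/eqP; congr (_ `^ _); ring.
Qed.

Lemma spectral_integral_le : exists2 C : R, 0 < C & forall n : nat,
  (\int[Delta]_x (Num.min 1 (enorm x / 2 ^+ n) `^ alpha)%:E <=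
   (C * (2 ^+ n) `^ (- (alpha * H)))%:E)%E.
Proof.
have p0 k : 0 < 2 ^+ k :> R by rewrite exprn_gt0.
have [J KJ] : exists J, K12 <= 2 ^+ J.
  exists (Num.bound K12); apply: (@le_trans _ _ (Num.bound K12)%:R).
    by have := archi_boundP (ltW K12_gt0); exact: ltW.
  by rewrite -natrX ler_nat ltnW// ltn_expl.
pose I0 := fine (\int[Delta]_x (Num.min 1 (enorm x `^ alpha))%:E)%E.
have min0 x : 0 <= Num.min 1 (enorm x `^ alpha).
  by rewrite le_min ler01 powR_ge0.
have mmin : measurable_fun setT (fun x : 'rV[R]_N => Num.min 1 (enorm x `^ alpha)).
  apply: measurable_minr => //.
  exact: (measurableT_comp (measurable_powR alpha) measurable_enorm).
have I0E : (\int[Delta]_x (Num.min 1 (enorm x `^ alpha))%:E)%E = I0%:E.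
  by rewrite fineK// ge0_fin_numE//; apply: integral_ge0 => x _; rewrite lee_fin.
have I00 : 0 <= I0 by rewrite fine_ge0// integral_ge0// => x _; rewrite lee_fin.
pose r := 2 `^ (- (alpha * (1 - H))) : R; pose s := 2 `^ (- (alpha * H)) : R.
have r1 : r < 1 by apply: powRN_lt1; rewrite ?ltr1n// mulr_gt0// subr_gt0.
have s1 : s < 1 by apply: powRN_lt1; rewrite ?ltr1n// mulr_gt0.
pose G := (1 - r)^-1 + (1 - s)^-1.
have G0 : 0 < G by rewrite addr_gt0// invr_gt0 subr_gt0.
(* Below radius [2^J] the density bound may fail. There [(|x| / 2^n)^alpha <= A 2^(- n alpha) min(1,
   |x|^alpha)], which is integrable, and [2^(- n alpha) <= 2^(- n alpha H)]. *)
pose A := (2 ^+ J) `^ alpha : R.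
have A0 : 0 < A by exact: powR_gt0.
pose B := 2 `^ alpha * (K11 * 4 ^+ N).
have B0 : 0 < B by rewrite !mulr_gt0 ?powR_gt0// exprn_gt0.
exists (A * I0 + B * G); first by rewrite ltr_wpDl ?mulr_gt0// mulr_ge0// ltW.
move=> n.
pose S i := if (J <= i)%N then shell i else set0.
have mS i : measurable (S i) by rewrite /S; case: ifP.
(* The factor [2^alpha] pays for replacing [|x| < 2^(i+1)] by [2^i]. *)
pose w i : R := 2 `^ alpha * Num.min 1 (2 ^+ i / 2 ^+ n) `^ alpha.
have w0 i : 0 <= w i by rewrite mulr_ge0// powR_ge0.
have mw i : measurable_fun setT (fun x => (w i * \1_(S i) x)%:E).
  by apply/measurable_EFinP; exact: measurable_funM.
have ws0 i x : (0 <= (w i * \1_(S i) x)%:E)%E by rewrite lee_fin mulr_ge0.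
have mpsi : measurable_fun setT (fun x : 'rV[R]_N =>
  Num.min 1 (enorm x / 2 ^+ n) `^ alpha).
  apply: (measurableT_comp (measurable_powR alpha)); apply: measurable_minr => //.
  by apply: measurable_funM => //; exact: measurable_enorm.
apply: (@le_trans _ _ (\int[Delta]_x
   ((A * (2 ^+ n) `^ (- alpha) * Num.min 1 (enorm x `^ alpha))%:E +
    \sum_(i <oo) (w i * \1_(S i) x)%:E))%E).
  apply: ge0_le_integral => //.
  - by move=> x _; rewrite lee_fin powR_ge0.
  - exact/measurable_EFinP.
  - apply: emeasurable_funD; last exact: ge0_emeasurable_sum.
    by apply/measurable_EFinP; exact: measurable_funM.
  - move=> x _; have [xJ|Jx] := ltP (enorm x) (2 ^+ J).
      apply: lee_paddr; first by apply: nneseries_ge0.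
      rewrite lee_fin.
      apply: (@le_trans _ _ ((enorm x / 2 ^+ n) `^ alpha)).
        apply: powR_le; first exact: ltW.
        + by rewrite le_min ler01 divr_ge0 ?enorm_ge0// ltW.
        + by rewrite ge_min lexx orbT.
      rewrite powRM ?enorm_ge0 ?invr_ge0 ?(ltW (p0 n))//.
      have -> : (2 ^+ n)^-1 = (2 ^+ n) `^ (- 1) :> R by rewrite powR_inv1// ltW.
      rewrite -powRrM mulN1r (mulrAC A) ler_wpM2r ?powR_ge0//.
      have A1 : 1 <= A.
        rewrite -[leLHS](pow1R alpha); apply: powR_le => //; first exact: ltW.
        by rewrite exprn_ege1// ler1n.
      rewrite minEle; case: ifPn => _; last by rewrite ler_peMl ?powR_ge0.
      by rewrite mulr1; apply: powR_le; rewrite ?enorm_ge0//; exact: ltW.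
    apply: lee_paddl; first by rewrite lee_fin !mulr_ge0 ?powR_ge0 ?(ltW A0).
    have x1 : 1 <= enorm x by apply: le_trans Jx; rewrite exprn_ege1// ler1n.
    have [i /andP[ix xi]] := powR2_itv x1.
    have Ji : (J <= i)%N.
      have := le_lt_trans Jx xi; rewrite ltr_eXn2l ?ltr1n//.
    apply: (@le_trans _ _ (w i * \1_(S i) x)%:E).
      have q0 : 0 <= 2 ^+ i / 2 ^+ n :> R by rewrite divr_ge0// ltW.
      rewrite /S Ji indicE mem_set// mulr1 lee_fin.
      have -> : w i = (2 * Num.min 1 (2 ^+ i / 2 ^+ n)) `^ alpha.
        by rewrite /w powRM// le_min ler01.
      have le2 : enorm x / 2 ^+ n <= 2 * (2 ^+ i / 2 ^+ n).
        by rewrite mulrA -exprS ler_wpM2r ?invr_ge0 ?(ltW (p0 n))// ltW.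
      apply: powR_le; first exact: ltW.
      - by rewrite le_min ler01 divr_ge0 ?enorm_ge0// ltW.
      - rewrite !minEle; case: ifPn; case: ifPn => //; rewrite -?ltNge; lra.
    rewrite (nneseries_split _ i.+1)// add0n big_nat_recr//= -addeA.
    apply: lee_paddl; first by apply: sume_ge0 => *; exact: ws0.
    by rewrite leeDl// nneseries_ge0.
rewrite ge0_integralD//; last 4 first.
- by move=> x _; rewrite lee_fin !mulr_ge0 ?powR_ge0 ?(ltW A0).
- by apply/measurable_EFinP; exact: measurable_funM.
- by move=> x _; exact: nneseries_ge0.
- exact: ge0_emeasurable_sum.
under eq_integral do rewrite EFinM.
rewrite ge0_integralZl_EFin//; last 3 first.
- by move=> x _; rewrite lee_fin.
- exact/measurable_EFinP.
- by rewrite mulr_ge0 ?powR_ge0 ?(ltW A0).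
rewrite I0E -EFinM mulrDl EFinD; apply: leeD.
  rewrite lee_fin (mulrAC A) ler_wpM2l ?mulr_ge0 ?(ltW A0)//.
  rewrite !powRN lef_pV2 ?posrE ?powR_gt0// ler_powR ?exprn_ege1 ?ler1n//.
  by rewrite -[leRHS]mulr1 ler_pM2l// ltW.
rewrite integral_nneseries//.
apply: (@le_trans _ _ (\sum_(i <oo) ((B * (2 ^+ n) `^ (- (alpha * H)))%:E *
   (r ^+ (n - i) * s ^+ (i - n))%:E))%E).
  apply: lee_nneseries => [i _ _|i _]; first exact: integral_ge0.
  under eq_integral do rewrite EFinM.
  rewrite ge0_integralZl_EFin//; last exact/measurable_EFinP.
  rewrite integral_indic// setIT.
  apply: (@le_trans _ _ ((w i)%:E * (K11 * 4 ^+ N * (2 ^+ i) `^ (- (alpha *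
    H)))%:E)%E).
    rewrite lee_wpmul2l ?lee_fin// /S; case: ifPn => [Ji|_].
      apply: shell_mass_le; apply: (le_trans KJ).
      by rewrite ler_weXn2l// ler1n.
    by rewrite measure0 lee_fin !mulr_ge0 ?powR_ge0 ?exprn_ge0// ltW.
  rewrite -!EFinM lee_fin /w.
  have := shell_weight_le n i; rewrite -/r -/s => h.
  have alg (a b c e g : R) : a * b * (c * e * g) = a * (c * e) * (b * g) by ring.
  rewrite alg -/B -[leRHS]mulrA; exact: (ler_wpM2l (ltW B0) h).
rewrite nneseriesZl; last first.
  by move=> i _; rewrite lee_fin mulr_ge0// exprn_ge0// powR_ge0.
apply: (@le_trans _ _ ((B * (2 ^+ n) `^ (- (alpha * H)))%:E * G%:E)%E).
  apply: lee_wpmul2l; first by rewrite lee_fin mulr_ge0 ?powR_ge0 ?(ltW B0).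
  by apply: nneseries_two_sided_geometric; rewrite ?powR_ge0.
by rewrite -EFinM lee_fin mulrAC.
Qed.

End spectral.

(** * Kernel bounds for neighbouring points *)

Section edges.
Context {R : realType}.

Lemma normc_cexpiB_le (a b : R) : Normc.normc (cexpi a - cexpi b) <= 2 /\
  Normc.normc (cexpi a - cexpi b) <= `|a - b|.
Proof.
(* The chord length of the unit circle; both bounds follow from it. *)
have e : Normc.normc (cexpi a - cexpi b) = 2 * `|sin ((a - b) / 2)|.
  rewrite normc_sqrtE.
  have -> : complex.Re (cexpi a - cexpi b) ^+ 2 + complex.Im (cexpi a - cexpi b)
    ^+ 2 =
      (2 * `|sin ((a - b) / 2)|) ^+ 2.
    rewrite exprMn real_normK ?num_real//.
    have := cosB1 (a - b); rewrite cosB.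
    have := cos2Dsin2 a; have := cos2Dsin2 b; rewrite /cexpi /=.
    set ca := cos a; set cb := cos b; set sa := sin a; set sb := sin b.
    set ss := sin _ ^+ 2; nra.
  by rewrite sqrtr_sqr ger0_norm// mulr_ge0.
rewrite e; split.
  rewrite -[leRHS]mulr1 ler_pM2l//.
  by rewrite ler_norml sin_geN1 sin_le1.
have := normr_sin_le ((a - b) / 2); rewrite normrM (@ger0_norm _ 2^-1)//.
set u := `|sin _|; set v := `|a - b|; lra.
Qed.

Context {N : nat}.

Lemma innerBl (s t x : 'rV[R]_N) : inner s x - inner t x = inner (s - t) x.
Proof.
by rewrite /inner -sumrB; apply: eq_bigr => i _; rewrite -mulrBl !mxE.
Qed.

Lemma normr_inner_le (s x : 'rV[R]_N) (r : R) : (forall i, `|s ord0 i| <= r) ->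
  `|inner s x| <= N%:R * (r * enorm x).
Proof.
move=> sr; rewrite /inner (le_trans (ler_norm_sum _ _ _))//.
rewrite mulr_natl -[N in _ *+ N]card_ord -sumr_const; apply: ler_sum => i _.
by rewrite normrM ler_pM// coord_le_enorm.
Qed.

(** The increment is at most 2 and at most [N |x| / 2^n]. As [N >= 1], the constant [2 N] covers
    both. *)
Lemma normc_cexpi_increment_le (s t x : 'rV[R]_N) (n : nat) : (0 < N)%N ->
  (forall i, `|s ord0 i - t ord0 i| <= (2 ^+ n)^-1) ->
  Normc.normc ((cexpi (inner s x) - 1) - (cexpi (inner t x) - 1)) <=
  2 * N%:R * Num.min 1 (enorm x / 2 ^+ n).
Proof.
move=> N0 st.
have N1 : 1 <= N%:R :> R by rewrite ler1n.
have p0 : 0 < 2 ^+ n :> R by rewrite exprn_gt0.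
have -> : (cexpi (inner s x) - 1) - (cexpi (inner t x) - 1) =
    cexpi (inner s x) - cexpi (inner t x) by ring.
have [h1 h2] := normc_cexpiB_le (inner s x) (inner t x).
rewrite innerBl in h2.
have := @normr_inner_le (s - t) x (2 ^+ n)^-1.
have st' i : `|(s - t) ord0 i| <= (2 ^+ n)^-1 by rewrite !mxE.
move=> /(_ st') h3.
have y0 : 0 <= enorm x / 2 ^+ n by rewrite divr_ge0 ?enorm_ge0// ltW.
rewrite (mulrC (_^-1)) in h3.
rewrite minEle; case: ifPn => _.
  by rewrite mulr1; lra.
apply: (le_trans h2); apply: (le_trans h3).
have : 0 <= N%:R * (enorm x / 2 ^+ n) by rewrite mulr_ge0.
by rewrite -(mulrA 2); set z := N%:R * _; lra.
Qed.

End edges.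

(** * Convergence of the p-series and Borel-Cantelli *)

Section p_series.
Context {R : realType}.

Lemma nneseries_le_cst (u : nat -> R) (c : R) : (forall n, 0 <= u n) ->
  (forall n, \sum_(k < n) u k <= c) -> (\sum_(n <oo) (u n)%:E <= c%:E)%E.
Proof.
move=> u0 uc; apply: lime_le.
  by apply: is_cvg_nneseries => n _ _; rewrite lee_fin.
by apply: nearW => n; rewrite sumEFin lee_fin big_mkord.
Qed.

(** With [a = m + 1], divide by [a^(- delta)]: it remains that [(a / m)^delta >= 1 + delta / a],
    which follows from [ln (a / m) >= 1 / a]. It makes the partial sums of the p-series
    telescope. *)
Lemma powR_telescope_ge (delta m : R) : 0 < delta -> 1 <= m ->
  delta * (m + 1) `^ (- (1 + delta)) <= m `^ (- delta) - (m + 1) `^ (- delta).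
Proof.
move=> d0 m1; have m0 : 0 < m by exact: lt_le_trans m1.
have a0 : 0 < m + 1 by rewrite ltr_wpDl// ltW.
set a := m + 1 in a0 *.
have am0 : 0 < a / m by rewrite divr_gt0.
have -> : m `^ (- delta) = a `^ (- delta) * (a / m) `^ delta.
  rewrite powRM ?invr_ge0 ?(ltW a0) ?(ltW m0)// mulrA.
  rewrite -powRD; last by rewrite (gt_eqF a0) implybT.
  rewrite addNr powRr0 mul1r.
  have -> : m^-1 = m `^ (- 1) by rewrite powR_inv1// ltW.
  by rewrite -powRrM mulN1r.
have -> : a `^ (- (1 + delta)) = a `^ (- delta) * a^-1.
  have -> : a^-1 = a `^ (- 1) by rewrite powR_inv1// ltW.
  by rewrite -powRD ?(gt_eqF a0) ?implybT//; congr powR; ring.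
rewrite mulrCA -[X in _ <= _ - X]mulr1 -mulrBr ler_wpM2l ?powR_ge0//.
have lnle : a^-1 <= ln (a / m).
  have -> : ln (a / m) = - ln (m / a) by rewrite -lnV ?posrE ?divr_gt0// invf_div.
  rewrite lerNr.
  have -> : m / a = 1 + - a^-1.
    by rewrite /a; field; rewrite gt_eqF.
  apply: le_ln1Dx; rewrite ltrNl opprK invf_lt1// /a; lra.
rewrite lerBrDr addrC /powR (gt_eqF am0).
apply: le_trans (expR_ge1Dx _); rewrite lerD2l ler_wpM2l// ltW//.
Qed.

Lemma p_series_lty (delta : R) : 0 < delta ->
  (\sum_(n <oo) ((n.+1%:R `^ (1 + delta))^-1)%:E < +oo :> \bar R)%E.
Proof.
move=> d0; apply: (@le_lt_trans _ _ (1 + delta^-1)%:E); last exact: ltry.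
apply: nneseries_le_cst => [n|n]; first by rewrite invr_ge0 powR_ge0.
suff H : \sum_(k < n.+1) (k.+1%:R `^ (1 + delta))^-1 <=
    1 + (1 - n.+1%:R `^ (- delta)) / delta :> R.
  have h : \sum_(k < n) (k.+1%:R `^ (1 + delta))^-1 <=
      \sum_(k < n.+1) (k.+1%:R `^ (1 + delta))^-1 :> R.
    by rewrite big_ord_recr/= lerDl invr_ge0 powR_ge0.
  apply: (le_trans h); apply: (le_trans H); rewrite lerD2l -[leRHS]mul1r.
  by rewrite ler_wpM2r ?invr_ge0 ?(ltW d0)// gerBl powR_ge0.
elim: n => [|n IH].
  by rewrite big_ord1 !powR1 invr1 subrr mul0r addr0.
rewrite big_ord_recr/=; apply: (le_trans (lerD IH (lexx _))).
rewrite -addrA lerD2l -powRN.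
have m1 : 1 <= n.+1%:R :> R by rewrite ler1n.
have := powR_telescope_ge d0 m1; rewrite natr1 => h.
have di0 : 0 < delta^-1 by rewrite invr_gt0.
rewrite -(ler_pM2r d0) mulrDl !divfK ?gt_eqF//.
rewrite (mulrC _ delta); lra.
Qed.

End p_series.

Definition level_bound (R : realType) (alpha H delta B : R) (n : nat) : R :=
  B * (2 ^+ n) `^ (- H) * n.+1%:R `^ ((1 + delta) * (2 / alpha)).

Section almost_sure.
Context {R : realType} {d : measure_display} {Omega : measurableType d}.
Variable P : probability Omega R.

Lemma borel_cantelli_ae (F : (set Omega)^nat) (c : nat -> R) :
  (forall n, measurable (F n)) -> (forall n, (P (F n) <= (c n)%:E)%E) ->
  (\sum_(n <oo) (c n)%:E < +oo)%E ->
  {ae P, forall w, \forall n \near \oo, ~ F n w}.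
Proof.
move=> mF Fc coo.
have F0 : P (lim_sup_set F) = 0%E.
  apply: lim_sup_set_cvg0 => //; apply: le_lt_trans coo.
  by apply: lee_nneseries => [n _ _|n _]; [exact: measure_ge0|exact: Fc].
exists (lim_sup_set F); split => //.
  apply: bigcap_measurable => // n _; exact: bigcup_measurable.
move=> w /= nev n _; apply: contrapT => nF; apply: nev.
exists n => // m /= nm Fm; apply: nF; by exists m.
Qed.

Lemma ae_probability1 (A : set Omega) : measurable A ->
  {ae P, forall w, A w} <-> P A = 1%E.
Proof.
move=> mA; split.
  move=> [S [mS PS sub]].
  have : P (~` A) = 0%E.
    apply/eqP; rewrite eq_le measure_ge0 andbT -PS; apply: le_measure;
      rewrite ?inE//.
    exact: measurableC.
  have fA : P A \is a fin_num by exact: fin_num_measure.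
  rewrite probability_setC// -(fineK fA) -EFinB => -[] h; congr _%:E; lra.
move=> PA; exists (~` A); split => //; first exact: measurableC.
by rewrite probability_setC// PA subee.
Qed.

Lemma measurable_RV_eq (Y Z : {RV P >-> R}) : measurable [set w | Y w = Z w].
Proof.
rewrite (_ : [set w | _] = ~` [set w | (0 < `|Y w - Z w|)%R]).
  apply: measurableC; apply: measurable_gt_cst; apply: measurableT_comp => //.
  exact: measurable_funB.
apply/seteqP; split => w /=.
  by move=> ->; rewrite subrr normr0 ltxx.
by rewrite normr_gt0 subr_eq0 => /negP; rewrite negbK => /eqP.
Qed.

End almost_sure.

(** * Dyadic chaining *)

Section dyadic.
Context {R : realType}.

Definition dyadic_floor (n : nat) (a : R) : R :=
  (Num.floor (2 ^+ n * a))%:~R / 2 ^+ n.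

Let p0 n : 0 < 2 ^+ n :> R.
Proof. by rewrite exprn_gt0. Qed.

Let floorP a : (Num.floor a)%:~R <= a /\ a < (Num.floor a)%:~R + 1 :> R.
Proof. by have := Num.Theory.floor_itv a; rewrite intrD => /andP[]. Qed.

Let dyadic_diff n (i j : int) : (`|i - j| <= 1)%R ->
  `|i%:~R / 2 ^+ n - j%:~R / 2 ^+ n| <= (2 ^+ n)^-1 :> R.
Proof.
move=> ij; rewrite -mulrBl normrM normfV (gtr0_norm (p0 n)).
rewrite -[leRHS]mul1r ler_pM2r ?invr_gt0//.
by rewrite -intrB -intr_norm -[leRHS]/(1%:~R) ler_int.
Qed.

(** The floor lies strictly between [j - 2] and [j + 2], and it is an integer. Both the stability of
    neighbours and the passage to the next level reduce to this. *)
Let floor_unique (a : R) (j : int) : j%:~R - 1 <= a -> a < j%:~R + 2 ->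
  (`|Num.floor a - j| <= 1)%R.
Proof.
move=> h1 h2; have [h3 h4] := floorP a.
have e1 : (Num.floor a)%:~R < (j + 2)%:~R :> R by rewrite intrD; lra.
have e2 : (j - 2)%:~R < (Num.floor a)%:~R :> R by rewrite intrB; lra.
rewrite !ltr_int in e1 e2; lia.
Qed.

Lemma dyadic_floor_close n a : `|a - dyadic_floor n a| <= (2 ^+ n)^-1.
Proof.
have [h1 h2] := floorP (2 ^+ n * a).
rewrite -(ler_pM2l (p0 n)) mulfV ?gt_eqF// -{1}(gtr0_norm (p0 n)) -normrM.
by rewrite mulrBr /dyadic_floor mulrCA mulfV ?gt_eqF// mulr1 ler_norml; lra.
Qed.

Lemma dyadic_floor_stable n a b : `|a - b| <= (2 ^+ n)^-1 ->
  `|dyadic_floor n a - dyadic_floor n b| <= (2 ^+ n)^-1.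
Proof.
move=> ab; apply: dyadic_diff; apply: floor_unique.
all: have [h1 h2] := floorP (2 ^+ n * b).
all: have : `|2 ^+ n * a - 2 ^+ n * b| <= 1 by
  rewrite -mulrBr normrM (gtr0_norm (p0 n)); move: ab;
  rewrite -(ler_pM2l (p0 n)) mulfV ?gt_eqF.
all: rewrite ler_norml; lra.
Qed.

Lemma dyadic_floor_refine n a :
  `|dyadic_floor n.+1 a - dyadic_floor n a| <= (2 ^+ n.+1)^-1.
Proof.
have -> : dyadic_floor n a = (2 * Num.floor (2 ^+ n * a))%:~R / 2 ^+ n.+1.
  by rewrite /dyadic_floor intrM exprS invfM mulrACA mulfV// mul1r.
apply: dyadic_diff; apply: floor_unique.
all: rewrite intrM exprS -mulrA; have [h1 h2] := floorP (2 ^+ n * a).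
all: lra.
Qed.

Context {N : nat}.
Implicit Types s t p q : 'rV[R]_N.

Definition row_dyadic_floor (n : nat) t : 'rV[R]_N :=
  \row_i dyadic_floor n (t ord0 i).

Definition row_close (n : nat) s t : Prop :=
  forall i, `|s ord0 i - t ord0 i| <= (2 ^+ n)^-1.

Definition row_cube (K : nat) t : Prop := forall i, `|t ord0 i| <= K%:R.

Lemma row_cube_exists t : exists K, row_cube K t.
Proof.
exists (\max_i Num.bound `|t ord0 i|)%N => i.
apply: (le_trans (ltW (archi_boundP (normr_ge0 _)))).
by rewrite ler_nat; apply: (@leq_bigmax _ (fun i => Num.bound `|t ord0 i|)).
Qed.

(** The points of mesh [2^-n] in [[-K, K]^N], indexed by a finite type so that they can serve as
    vertices of a graph. *)
Definition grid_point (K n : nat) (k : {ffun 'I_N -> 'I_(2 * K * 2 ^ n).+1}) :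
  'rV[R]_N := \row_i ((k i)%:R / 2 ^+ n - K%:R).

Lemma row_dyadic_floor_grid K n t : row_cube K t ->
  exists k : {ffun 'I_N -> 'I_(2 * K * 2 ^ n).+1},
    row_dyadic_floor n t = grid_point k.
Proof.
move=> tK; pose m i : int := Num.floor (2 ^+ n * t ord0 i) + (K * 2 ^ n)%N%:Z.
have K2 : (K * 2 ^ n)%N%:R = K%:R * 2 ^+ n :> R by rewrite natrM natrX.
have mP i : 0 <= m i /\ m i <= (2 * K * 2 ^ n)%N%:Z.
  have := tK i; rewrite ler_norml => /andP[t1 t2].
  have h1 : - (K%:R * 2 ^+ n) <= 2 ^+ n * t ord0 i.
    by rewrite -mulNr mulrC ler_pM2l.
  have h2 : 2 ^+ n * t ord0 i <= K%:R * 2 ^+ n by rewrite mulrC ler_pM2r.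
  have [f1 f2] := floorP (2 ^+ n * t ord0 i).
  split.
    suff : (- (K * 2 ^ n)%N%:Z - 1)%:~R < (Num.floor (2 ^+ n * t ord0 i))%:~R :> R.
      by rewrite ltr_int /m; lia.
    by rewrite intrB intrN -pmulrn K2; lra.
  suff : (Num.floor (2 ^+ n * t ord0 i))%:~R <= ((K * 2 ^ n)%N%:Z)%:~R :> R.
    by rewrite ler_int /m; lia.
  by rewrite -pmulrn K2; lra.
exists [ffun i => inord `|m i|%N]; apply/rowP => i; rewrite !mxE ffunE.
have [m0 m1] := mP i.
rewrite inordK; last by lia.
have -> : (`|m i|%N)%:R = (m i)%:~R :> R by rewrite -[in RHS](gez0_abs m0) pmulrn.
rewrite /m intrD -pmulrn K2 /dyadic_floor mulrDl mulfK ?gt_eqF//.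
by rewrite addrK.
Qed.

Definition grid_bound (eta : nat -> R) (K n : nat) (x : 'rV[R]_N -> R) : Prop :=
  forall k l : {ffun 'I_N -> 'I_(2 * K * 2 ^ n).+1},
    row_close n (grid_point k) (grid_point l) ->
    `|x (grid_point k) - x (grid_point l)| <= eta n.

(** A condition on countably many values of [x]: it is measurable in the random point and
    insensitive to the choice of a version. The threshold may depend on the cube. *)
Definition grid_regular (eta : nat -> R) (x : 'rV[R]_N -> R) : Prop :=
  forall K : nat, \forall n \near \oo, grid_bound eta K n x.

Definition dyadic_limit (x : 'rV[R]_N -> R) t : R :=
  lim (x (row_dyadic_floor n t) @[n --> \oo]).

Variables (eta : nat -> R) (rho : R) (n1 : nat).
Hypotheses (eta_ge0 : forall n, 0 <= eta n) (rho_ge0 : 0 <= rho) (rho_lt1 : rho < 1)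
  (eta_rho : forall n, (n1 <= n)%N -> eta n.+1 <= rho * eta n).

Let T := (1 - rho)^-1.

Lemma ratio_cvg0 : eta n @[n --> \oo] --> 0.
Proof.
have h k : eta (k + n1)%N <= eta n1 * rho ^+ k.
  elim: k => [|k IH]; first by rewrite expr0 mulr1.
  rewrite addSn exprSr mulrA; apply: (le_trans (eta_rho (leq_addl _ _))).
  by rewrite mulrC ler_wpM2r.
rewrite -(cvg_shiftn n1).
apply: (@squeeze_cvgr _ _ _ _ (fun=> 0) (fun k => eta n1 * rho ^+ k)).
- by apply: nearW => k; rewrite eta_ge0 h.
- exact: cvg_cst.
- by apply: cvg_geometric; rewrite ger0_norm.
Qed.

Section regular.
Variable x : 'rV[R]_N -> R.
Hypothesis reg : grid_regular eta x.

(** Telescoping against the potential [T * eta]: one step costs [eta (j + 1) <= T * eta j - T * eta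
    (j + 1)], because [T (1 - rho) = 1] gives [(1 + T) rho <= T]. *)
Lemma dyadic_chain K : exists n0, forall n m t, (n0 <= n)%N -> (n <= m)%N ->
  row_cube K t -> `|x (row_dyadic_floor m t) - x (row_dyadic_floor n t)| <=
    T * eta n - T * eta m.
Proof.
(* The lower-left approximation of a point of the cube may leave it, by at most 1; hence the larger
   cube. *)
have [n2 _ hn2] := reg K.+1.
exists (maxn n1 n2) => n m t; rewrite geq_max => /andP[n1n n2n] nm tK.
rewrite -(subnKC nm); elim: (m - n)%N => [|k IH].
  by rewrite addn0 !subrr normr0.
rewrite addnS; set j := (n + k)%N in IH *.
have n1j : (n1 <= j)%N by rewrite (leq_trans n1n)// leq_addr.
have n2j : (n2 <= j.+1)%N by rewrite leqW// (leq_trans n2n)// leq_addr.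
have tK1 : row_cube K.+1 t.
  by move=> i; apply: (le_trans (tK i)); rewrite ler_nat.
have step : `|x (row_dyadic_floor j.+1 t) - x (row_dyadic_floor j t)| <= eta j.+1.
  have [k1 e1] := row_dyadic_floor_grid j.+1 tK1.
  have t'K1 : row_cube K.+1 (row_dyadic_floor j t).
    move=> i; rewrite mxE -natr1; have := dyadic_floor_close j (t ord0 i).
    have := tK i; have : (2 ^+ j)^-1 <= 1 :> R by rewrite invf_le1// exprn_ege1//
      ler1n.
    have := ler_distD (t ord0 i) (dyadic_floor j (t ord0 i)) 0.
    rewrite !subr0 (distrC (dyadic_floor _ _)); lra.
  (* A grid point of level [j] is also one of level [j + 1], so the step is an edge of that finer
     grid. *)
  have ff : row_dyadic_floor j.+1 (row_dyadic_floor j t) = row_dyadic_floor j t.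
    apply/rowP => i; rewrite !mxE /dyadic_floor exprS.
    set z := Num.floor (2 ^+ j * _).
    have -> : 2 * 2 ^+ j * (z%:~R / 2 ^+ j) = (2 * z)%:~R :> R.
      by rewrite intrM -mulrA; congr (_ * _); rewrite mulrCA mulfV ?mulr1 ?gt_eqF.
    by rewrite Num.Theory.intrKfloor intrM invfM mulrACA mulfV// mul1r.
  have [k2 e2] := row_dyadic_floor_grid j.+1 t'K1.
  rewrite ff in e2; rewrite e1 e2; apply: (hn2 j.+1 n2j).
  by rewrite -e1 -e2 => i; rewrite !mxE; exact: dyadic_floor_refine.
have h := ler_distD (x (row_dyadic_floor j t)) (x (row_dyadic_floor j.+1 t))
  (x (row_dyadic_floor n t)).
have r0 : 0 < 1 - rho by rewrite subr_gt0.
have T1 : T * (1 - rho) = 1 by rewrite mulVf ?gt_eqF.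
have T0 : 0 <= T by rewrite invr_ge0 ltW.
have key : (1 + T) * eta j.+1 <= T * eta j.
  have := eta_rho n1j => er; have e0 := eta_ge0 j.
  apply: (@le_trans _ _ ((1 + T) * (rho * eta j))).
    by rewrite ler_wpM2l// addr_ge0.
  rewrite mulrA ler_wpM2r//.
  nra.
lra.
Qed.

Lemma dyadic_limit_cvg t : x (row_dyadic_floor n t) @[n --> \oo] --> dyadic_limit
  x t.
Proof.
have [K tK] := row_cube_exists t.
have [n0 hn0] := dyadic_chain K.
have T0 : 0 < T by rewrite invr_gt0 subr_gt0.
apply: cauchy_cvg; apply: cauchy_exP => e e0.
have Te : 0 < e / T by rewrite divr_gt0.
have /cvgrPdist_lt/(_ _ Te)[n2 _ hn2] := ratio_cvg0.
pose n := maxn n0 n2.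
exists (x (row_dyadic_floor n t)).
exists n => // m /= nm; rewrite /ball /= distrC.
apply: le_lt_trans (hn0 n m t _ nm tK) _; first by rewrite leq_maxl.
have := hn2 n (leq_maxr _ _); rewrite sub0r normrN ger0_norm// ltr_pdivlMr// => h.
have := mulr_ge0 (ltW T0) (eta_ge0 m); lra.
Qed.

Lemma dyadic_limit_dist K : exists n0, forall n t, (n0 <= n)%N -> row_cube K t ->
  `|dyadic_limit x t - x (row_dyadic_floor n t)| <= T * eta n.
Proof.
have [n0 hn0] := dyadic_chain K; exists n0 => n t n0n tK.
have T0 : 0 < T by rewrite invr_gt0 subr_gt0.
have c : `|x (row_dyadic_floor m t) - x (row_dyadic_floor n t)| @[m --> \oo] -->
    `|dyadic_limit x t - x (row_dyadic_floor n t)|.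
  by apply: cvg_norm; apply: cvgB; [exact: dyadic_limit_cvg|exact: cvg_cst].
rewrite -(cvg_lim _ c)//; apply: limr_le; first exact: (cvgP _ c).
exists n => // m /= nm; apply: (le_trans (hn0 _ _ _ n0n nm tK)).
by rewrite gerBl mulr_ge0// ltW.
Qed.

(** Each of the two points pays [T * eta n] to reach its approximation, and the two approximations
    are neighbours or equal, at cost [eta n]. *)
Lemma dyadic_limit_modulus K : exists n0, forall n s t, (n0 <= n)%N ->
  row_cube K s -> row_cube K t -> row_close n s t ->
  `|dyadic_limit x s - dyadic_limit x t| <= (2 * T + 1) * eta n.
Proof.
have [n0 hn0] := dyadic_limit_dist K; have [n2 _ hn2] := reg K.
exists (maxn n0 n2) => n s t; rewrite geq_max => /andP[n0n n2n] sK tK st.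
have h1 := hn0 n s n0n sK; have h2 := hn0 n t n0n tK.
have [k1 e1] := row_dyadic_floor_grid n sK.
have [k2 e2] := row_dyadic_floor_grid n tK.
have h3 : `|x (row_dyadic_floor n s) - x (row_dyadic_floor n t)| <= eta n.
  rewrite e1 e2; apply: hn2 => //; rewrite -e1 -e2 => i.
  by rewrite !mxE; exact: dyadic_floor_stable.
have h4 := ler_distD (x (row_dyadic_floor n s)) (dyadic_limit x s) (dyadic_limit
  x t).
have h5 := ler_distD (x (row_dyadic_floor n t)) (x (row_dyadic_floor n s))
  (dyadic_limit x t).
rewrite distrC in h2; lra.
Qed.

End regular.

End dyadic.

(** * Continuity of the dyadic limit and decay of the level bounds *)

Section dyadic_continuity.
Context {R : realType} {N : nat}.
Implicit Types s t : 'rV[R]_N.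

Lemma inv_exp2_lt (e : R) : 0 < e -> exists n, forall m,
  (n <= m)%N -> (2 ^+ m)^-1 < e.
Proof.
move=> e0; have ei0 : 0 <= e^-1 by rewrite invr_ge0 ltW.
exists (Num.bound e^-1) => m nm; rewrite -(invrK e) ltf_pV2 ?posrE ?invr_gt0
  ?exprn_gt0//.
apply: (lt_le_trans (archi_boundP ei0)); rewrite -natrX ler_nat.
exact: leq_trans nm (ltnW (ltn_expl _ _)).
Qed.

Lemma row_dyadic_floor_cvg t : row_dyadic_floor n t @[n --> \oo] --> t.
Proof.
apply/cvg_ballP => e e0; have [n hn] := inv_exp2_lt e0.
exists n => // m /= nm; split => // i j; rewrite (ord1 i) mxE /ball /=.
exact: le_lt_trans (dyadic_floor_close m (t ord0 j)) (hn m nm).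
Qed.

Lemma dyadic_limit_id (x : 'rV[R]_N -> R) t : continuous x ->
  dyadic_limit x t = x t.
Proof.
move=> xc; apply/cvg_lim => //.
exact: (cvg_comp _ _ (@row_dyadic_floor_cvg t) (xc t)).
Qed.

Variables (eta : nat -> R) (rho : R) (n1 : nat).
Hypotheses (eta_ge0 : forall n, 0 <= eta n) (rho_ge0 : 0 <= rho) (rho_lt1 : rho < 1)
  (eta_rho : forall n, (n1 <= n)%N -> eta n.+1 <= rho * eta n).

Lemma dyadic_limit_continuous (x : 'rV[R]_N -> R) : grid_regular eta x ->
  continuous (dyadic_limit x).
Proof.
move=> reg t; apply/(@cvgrPdist_lt _ _ _ _ (nbhs_filter t)) => e e0.
have [K tK] := row_cube_exists t.
have [n0 hn0] := dyadic_limit_modulus eta_ge0 rho_ge0 rho_lt1 eta_rho reg K.+1.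
pose c := 2 * (1 - rho)^-1 + 1.
have c0 : 0 < c by rewrite ltr_wpDl// mulr_ge0// invr_ge0 subr_ge0 ltW.
have ec : 0 < e / c by rewrite divr_gt0.
have /cvgrPdist_lt/(_ _ ec)[n2 _ hn2] := ratio_cvg0 eta_ge0 rho_ge0 rho_lt1 eta_rho.
pose n := maxn n0 n2.
have p0 : 0 < (2 ^+ n)^-1 :> R by rewrite invr_gt0 exprn_gt0.
apply/nbhs_ballP; exists (2 ^+ n)^-1 => //= s ts.
have ts' i : `|t ord0 i - s ord0 i| < (2 ^+ n)^-1 by exact: (ts.2 ord0 i).
have tK1 : row_cube K.+1 t by move=> i; apply: (le_trans (tK i)); rewrite ler_nat.
have sK1 : row_cube K.+1 s.
  move=> i; rewrite -natr1; have := tK i; have := ts' i.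
  have : (2 ^+ n)^-1 <= 1 :> R by rewrite invf_le1 ?exprn_gt0// exprn_ege1// ler1n.
  have := ler_distD (t ord0 i) (s ord0 i) 0.
  rewrite !subr0 (distrC (s _ _)); lra.
apply: le_lt_trans (hn0 n t s (leq_maxl _ _) tK1 sK1 (fun i => ltW (ts' i))) _.
have := hn2 n (leq_maxr _ _); rewrite sub0r normrN ger0_norm// ltr_pdivlMr//.
by rewrite mulrC.
Qed.

End dyadic_continuity.

Section level_bound_ratio.
Context {R : realType}.
Variables (alpha H delta B : R).
Hypotheses (alpha_gt0 : 0 < alpha) (H_gt0 : 0 < H) (delta_gt0 : 0 < delta) (B_gt0
  : 0 < B).

Lemma level_bound_ge0 n : 0 <= level_bound alpha H delta B n.
Proof. by rewrite !mulr_ge0 ?powR_ge0// ltW. Qed.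

Lemma level_bound_ratio : exists rho n1, [/\ 0 <= rho, rho < 1 & forall n,
  (n1 <= n)%N ->
  level_bound alpha H delta B n.+1 <= rho * level_bound alpha H delta B n].
Proof.
pose ga := (1 + delta) * (2 / alpha).
have ga0 : 0 < ga by rewrite mulr_gt0 ?divr_gt0// addr_gt0.
pose h : R := 2 `^ (- H).
have h0 : 0 < h by exact: powR_gt0.
have h1 : h < 1 by apply: powRN_lt1; rewrite ?ltr1n.
(* The limiting ratio of consecutive bounds is [h = 2^(-H)]; any number strictly between [h] and 1
   leaves room for the polynomial factor. *)
pose rho := (1 + h) / 2.
have rho1 : rho < 1 by rewrite /rho; lra.
have hrho : h < rho by rewrite /rho; lra.
pose r := rho / h.
have r1 : 1 < r by rewrite ltr_pdivlMr// mul1r.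
(* Chosen so that [(1 + z)^ga = rho / h]. Once [z (n + 1) >= 1], one has
   [n + 2 <= (1 + z) (n + 1)]. *)
pose z := r `^ ga^-1 - 1.
have z0 : 0 < z.
  rewrite subr_gt0 -(pow1R ga^-1) gt0_ltr_powR ?invr_gt0 ?nnegrE//.
  by rewrite ltW// (lt_trans ltr01).
have zi0 : 0 <= z^-1 by rewrite invr_ge0 ltW.
exists rho, (Num.bound z^-1); split => //; first by rewrite ltW// (lt_trans h0).
move=> n nz; rewrite /level_bound -/ga.
have n0 : 0 < n.+1%:R :> R by rewrite ltr0n.
have nz' : z^-1 <= n.+1%:R.
  by apply: (le_trans (ltW (archi_boundP zi0))); rewrite ler_nat leqW.
have ratio : n.+2%:R `^ ga <= r * n.+1%:R `^ ga.
  have -> : r = (r `^ ga^-1) `^ ga.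
    by rewrite -powRrM mulVf ?gt_eqF// powRr1// ltW// (lt_trans ltr01).
  rewrite -powRM ?powR_ge0 ?(ltW n0)//; apply: powR_le => //; first exact: ltW.
  have -> : r `^ ga^-1 = 1 + z by rewrite /z addrC subrK.
  rewrite mulrDl mul1r -natr1 lerD2l.
  by rewrite -(ler_pM2l z0) mulfV ?gt_eqF// in nz'.
have e2 : (2 ^+ n.+1) `^ (- H) = h * (2 ^+ n) `^ (- H).
  by rewrite exprS powRM// exprn_ge0.
rewrite e2.
have q0 : 0 <= B * (h * (2 ^+ n) `^ (- H)) by rewrite !mulr_ge0 ?powR_ge0// ltW.
apply: (le_trans (ler_wpM2l q0 ratio)).
rewrite /r le_eqVlt; apply/orP; left; apply/eqP.
set a := powR _ (- H); set b := powR _ ga.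
by field; rewrite gt_eqF.
Qed.

End level_bound_ratio.

(** * The random field *)

Section harmonizable_field_bounds.
Context {R : realType} {d : measure_display} {Omega : measurableType d}.
Variables (P : probability Omega R) (N : nat)
    (alpha H K11 K12 : R) (Delta : {measure set 'rV[R]_N -> \bar R})
    (f : 'rV[R]_N -> R) (M : set 'rV[R]_N -> Omega -> R[i])
    (X : 'rV[R]_N -> {RV P >-> R}).
Hypotheses (N_gt0 : (0 < N)%N)
  (alpha_gt0 : 0 < alpha) (alpha_lt2 : alpha < 2) (H_gt0 : 0 < H) (H_lt1 : H < 1)
  (K11_gt0 : 0 < K11) (K12_gt0 : 0 < K12).
Hypothesis rsmM : rot_inv_stable_random_measure P alpha Delta M.
Hypothesis Delta_int :
  (\int[Delta]_x (Num.min 1 (enorm x `^ alpha))%:E < +oo)%E.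
Hypotheses (mf : measurable_fun setT f) (f_ge0 : forall x, 0 <= f x).
Hypothesis DeltaE : forall A, measurable A ->
  Delta A = (\int[lebesgue_row N]_(x in A) (f x)%:E)%E.
Hypothesis f_le : forall x, K12 <= enorm x ->
  f x <= K11 * enorm x `^ (- (alpha * H + N%:R)).
Hypothesis hX : harmonizable_field alpha Delta M X.

Lemma edge_maximal_inequality : exists2 b : R, 0 < b &
  forall (n : nat) (I E : finType) (pt : I -> 'rV[R]_N) (u v : E -> I) (q lam : R),
  (forall e i, `|pt (u e) ord0 i - pt (v e) ord0 i| <= (2 ^+ n)^-1) -> 1 <= q ->
  (P [set w | exists e, (b * (2 ^+ n) `^ (- H) * (2 * q `^ (2 / alpha) + lam + 1) <
     `|X (pt (u e)) w - X (pt (v e)) w|)%R] <=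
  (80 * qpow_const alpha / q + #|E|%:R * (2 * expR (40 - lam)))%:E)%E.
Proof.
have [C C0 hC] := spectral_integral_le alpha_gt0 H_gt0 H_lt1 K11_gt0 K12_gt0
  Delta_int mf f_ge0 DeltaE f_le.
have N0 : 0 < N%:R :> R by rewrite ltr0n.
pose b := 2 * N%:R * C `^ alpha^-1.
have b0 : 0 < b by rewrite !mulr_gt0// powR_gt0.
exists b => // n I E pt u v q lam close q1.
have /choice[Y hY] : forall i, exists Y : Omega -> R[i],
   is_stochastic_integral P alpha Delta M (fun x => cexpi (inner (pt i) x) - 1) Y /\
   forall w, X (pt i) w = complex.Re (Y w).
  by move=> i; have [Y Y1 Y2] := hX (pt i); exists Y.
have p0 : 0 < 2 ^+ n :> R by rewrite exprn_gt0.
pose phi (x : 'rV[R]_N) := 2 * N%:R * Num.min 1 (enorm x / 2 ^+ n).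
have min0 (x : 'rV[R]_N) : 0 <= Num.min 1 (enorm x / 2 ^+ n).
  by rewrite le_min ler01 divr_ge0 ?enorm_ge0// ltW.
have mmin : measurable_fun setT (fun x : 'rV[R]_N => Num.min 1 (enorm x / 2 ^+ n)).
  apply: measurable_minr => //.
  by apply: measurable_funM => //; exact: measurable_enorm.
have mphi : measurable_fun setT phi by exact: measurable_funM.
have phi0 x : 0 <= phi x by rewrite !mulr_ge0.
pose bn := b * (2 ^+ n) `^ (- H).
have bn0 : 0 < bn by rewrite mulr_gt0// powR_gt0.
have phi_int : (\int[Delta]_x (phi x `^ alpha)%:E <= (bn `^ alpha)%:E)%E.
  have phiE x : phi x `^ alpha =
      (2 * N%:R) `^ alpha * Num.min 1 (enorm x / 2 ^+ n) `^ alpha.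
    by apply: powRM; [rewrite mulr_ge0|exact: min0].
  under eq_integral do rewrite phiE EFinM.
  rewrite ge0_integralZl_EFin ?powR_ge0//; last 2 first.
  - by move=> x _; rewrite lee_fin powR_ge0.
  - by apply/measurable_EFinP; exact: (measurableT_comp (measurable_powR alpha)
    mmin).
  apply: le_trans (lee_wpmul2l _ (hC n)) _; first by rewrite lee_fin powR_ge0.
  rewrite -EFinM lee_fin /bn /b !powRM ?mulr_ge0 ?powR_ge0 ?(ltW N0)// -!powRrM.
  rewrite mulVf ?gt_eqF// powRr1 ?(ltW C0)// mulrA.
  by rewrite mulNr (mulrC H).
have := @stochastic_integral_maximal_inequality _ _ _ _ _ P alpha Delta M
  alpha_gt0 alpha_lt2 rsmM I E _ Y u v phi bn bn0 (fun i => (hY i).1) mphi phi0 _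
  phi_int q lam q1.
move=> /(_ (fun e x => normc_cexpi_increment_le x N_gt0 (close e))).
congr (P _ <= _)%E; apply/seteqP; split => w /= [e he]; exists e; move: he.
  by rewrite !(hY _).2.
by rewrite !(hY _).2.
Qed.

(** [B] is chosen before the graphs and before [A], so one [B] serves all cubes and all single
    points. The growth [(4^N)^n] is that of pairs of grid points of mesh [2^-n]. *)
Lemma eventually_level_bound (delta : R) : 0 < delta -> exists2 B : R, 0 < B &
  forall (I E : nat -> finType) (pt : forall n, I n -> 'rV[R]_N)
    (u v : forall n, E n -> I n) (A : R),
  (forall n e i, `|pt n (u n e) ord0 i - pt n (v n e) ord0 i| <= (2 ^+ n)^-1) ->
  (forall n, #|E n|%:R <= A * (4 ^+ N) ^+ n) ->
  {ae P, forall w, \forall n \near \oo, forall e,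
    `|X (pt n (u n e)) w - X (pt n (v n e)) w| <= level_bound alpha H delta B n}.
Proof.
move=> d0.
have [b b0 hb] := edge_maximal_inequality.
have N4 : 1 <= 4 ^+ N :> R by rewrite exprn_ege1// ler1n.
(* With [lam n = n c], the factor [expR (- lam n)] outweighs the number of edges and leaves
   [2^-n]. *)
pose c : R := ln (2 * 4 ^+ N).
have c0 : 0 <= c by rewrite ln_ge0//; lra.
pose ga := (1 + delta) * (2 / alpha).
have ga1 : 1 <= ga.
  have h2 : 1 <= 2 / alpha by rewrite ler_pdivlMr// mul1r ltW.
  rewrite /ga; nra.
(* The threshold [2 (n+1)^ga + n c + 1] is at most [(3 + c) (n+1)^ga], because [ga >= 1]. *)
exists (b * (3 + c)); first by rewrite mulr_gt0//; lra.
move=> I E pt u v A close cardE.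
have A0 : 0 <= A.
  by have := cardE 0%N; rewrite expr0 mulr1; exact: le_trans.
pose q n : R := n.+1%:R `^ (1 + delta).
have q1 n : 1 <= q n.
  by rewrite /q -[leLHS](powRr0 n.+1%:R) ler_powR ?ler1n//; lra.
have qga n : q n `^ (2 / alpha) = n.+1%:R `^ ga by rewrite /q -powRrM.
pose lam n : R := n%:R * c.
pose F n := [set w | exists e, (b * (2 ^+ n) `^ (- H) *
  (2 * q n `^ (2 / alpha) + lam n + 1) <
  `|X (pt n (u n e)) w - X (pt n (v n e)) w|)%R].
have mF n : measurable (F n).
  apply: measurable_fin_exists => e; apply: measurable_gt_cst.
  by apply: measurableT_comp => //; exact: measurable_funB.
pose C1 := 80 * qpow_const alpha.
pose C2 := A * (2 * expR 40).
have C10 : 0 <= C1 by rewrite mulr_ge0// ltW// qpow_const_gt0.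
have C20 : 0 <= C2 by rewrite !mulr_ge0// expR_ge0.
have FP n : (P (F n) <= (C1 * (n.+1%:R `^ (1 + delta))^-1 + C2 * 2^-1 ^+ n)%:E)%E.
  apply: (le_trans (hb n (I n) (E n) (pt n) (u n) (v n) (q n) (lam n) (close n)
    (q1 n))).
  rewrite lee_fin lerD2l.
  apply: (@le_trans _ _ (A * (4 ^+ N) ^+ n * (2 * expR (40 - lam n)))).
    by rewrite ler_wpM2r// mulr_ge0// expR_ge0.
  rewrite expRB /lam mulr_natl expRM_natl lnK ?posrE ?mulr_gt0 ?exprn_gt0//.
  rewrite exprMn /C2 exprVn.
  have z0 : (4 ^+ N) ^+ n != 0 :> R by rewrite !expf_neq0.
  have z1 : 2 ^+ n != 0 :> R by rewrite expf_neq0.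
  rewrite le_eqVlt; apply/orP; left; apply/eqP.
  set z2 := (4 ^+ N) ^+ n in z0 *; set z3 := 2 ^+ n in z1 *.
  by field; rewrite z0 z1.
have Fsum : (\sum_(n <oo) (C1 * (n.+1%:R `^ (1 + delta))^-1 + C2 * 2^-1 ^+ n)%:E
  < +oo :> \bar R)%E.
  under eq_eseriesr do rewrite EFinD.
  rewrite nneseriesD; last 2 first.
  - by move=> n _ _; rewrite lee_fin mulr_ge0// invr_ge0 powR_ge0.
  - by move=> n _ _; rewrite lee_fin mulr_ge0// exprn_ge0// invr_ge0.
  rewrite lte_add_pinfty//.
    under eq_eseriesr do rewrite EFinM.
    rewrite nneseriesZl; last by move=> n _; rewrite lee_fin invr_ge0 powR_ge0.
    rewrite lte_mul_pinfty ?lee_fin//.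
    exact: p_series_lty.
  rewrite nneseries_geometric ?ltry// ger0_norm ?invr_ge0// invf_lt1// ltr1n//.
have := borel_cantelli_ae mF FP Fsum.
apply: filterS => w; apply: filterS => n nF e.
rewrite leNgt; apply/negP => h; apply: nF; exists e; apply: le_lt_trans h.
have alg (x y z t : R) : x * y * z * t = x * z * (y * t) by ring.
rewrite /level_bound -/ga alg ler_wpM2l//; first by rewrite mulr_ge0 ?powR_ge0//
  ltW.
rewrite qga.
have p1 : 1 <= n.+1%:R `^ ga by rewrite -[leLHS](powRr0 n.+1%:R) ler_powR
  ?ler1n//; lra.
have p2 : n%:R <= n.+1%:R `^ ga.
  apply: (@le_trans _ _ n.+1%:R); first by rewrite ler_nat.
  by rewrite -[leLHS](powRr1 (ler0n _ _)) ler_powR ?ler1n.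
have : lam n <= n.+1%:R `^ ga * c by rewrite ler_wpM2r.
set y := powR _ _ in p1 p2 *; lra.
Qed.

(** The grid estimate never sees a point [t] without dyadic coordinates. The second statement, with
    one edge per level, links [X t] to the grids and will identify the dyadic limit with [X t]. *)
Lemma ae_grid_regular (delta : R) : 0 < delta -> exists2 B : R, 0 < B &
  {ae P, forall w, grid_regular (level_bound alpha H delta B) (fun t => X t w)} /\
  forall t, {ae P, forall w, \forall n \near \oo,
    `|X t w - X (row_dyadic_floor n t) w| <= level_bound alpha H delta B n}.
Proof.
move=> d0.
have [B B0 hB] := eventually_level_bound d0.
exists B => //; split.
  apply: ae_foralln => K.
  pose I n : finType := {ffun 'I_N -> 'I_(2 * K * 2 ^ n).+1}.
  pose E n : finType := (I n * I n)%type.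
  pose close n (k l : I n) : bool :=
    [forall i, `|grid_point k ord0 i - grid_point l ord0 i| <= (2 ^+ n)^-1 :> R].
  pose u n (e : E n) : I n := e.1.
  (* a pair that is not close is replaced by a trivial edge *)
  pose v n (e : E n) : I n := if close n e.1 e.2 then e.2 else e.1.
  have uv n e i : `|grid_point (u n e) ord0 i - grid_point (v n e) ord0 i| <=
      (2 ^+ n)^-1 :> R.
    rewrite /u /v; case: ifPn => [/forallP//|_].
    by rewrite subrr normr0 invr_ge0 exprn_ge0.
  (* All pairs are counted, not only neighbours: [2 K 2^n + 1 <= (2 K + 1) 2^n] per coordinate, to
     the power [N], squared. *)
  have cardE n : #|E n|%:R <= ((2 * K).+1%:R ^+ N) ^+ 2 * (4 ^+ N) ^+ n :> R.
    rewrite card_prod card_ffun !card_ord natrM natrX -expr2.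
    have -> : (4 ^+ N) ^+ n = ((2 ^+ n) ^+ N) ^+ 2 :> R.
      by have -> : 4 = 2 ^+ 2 :> R; [rewrite -natrX|rewrite -!exprM;
        congr (_ ^+ _); lia].
    rewrite -!exprMn ler_pXn2r ?nnegrE ?exprn_ge0 ?mulr_ge0 ?exprn_ge0//.
    have [->|N'] := posnP N; first by rewrite !expr0.
    rewrite ler_pXn2r ?nnegrE ?mulr_ge0 ?exprn_ge0//.
    rewrite -natrX -natrM ler_nat.
    by rewrite mulSn -addn1 addnC leq_add2r expn_gt0.
  have := hB I E (fun n k => grid_point k) u v _ uv cardE.
  apply: filterS => w; apply: filterS => n h k l kl.
  have := h (k, l); rewrite /u /v /=; case: ifPn => // /negP[].
  exact/forallP.
move=> t.
pose pt (n : nat) (b : bool) := if b then t else row_dyadic_floor n t.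
have := hB (fun=> bool) (fun=> unit) pt (fun _ _ => true) (fun _ _ => false) 1.
have h1 n (e : unit) (i : 'I_N) : `|pt n true ord0 i - pt n false ord0 i| <= (2
  ^+ n)^-1.
  by rewrite mxE; exact: dyadic_floor_close.
have h2 n : #|(unit : finType)|%:R <= 1 * (4 ^+ N) ^+ n :> R.
  by rewrite card_unit mul1r !exprn_ege1// ler1n.
move=> /(_ h1 h2); apply: filterS => w; apply: filterS => n h.
exact: h tt.
Qed.

Lemma measurable_grid_regular (eta : nat -> R) :
  measurable [set w | grid_regular eta (fun t => X t w)].
Proof.
rewrite (_ : [set w | _] = \bigcap_K \bigcup_n0 \bigcap_(n in [set n | (n0 <= n)%N])
    [set w | grid_bound eta K n (fun t => X t w)]); last first.
  apply/seteqP; split => w /=.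
    by move=> reg K _; have [n0 _ h] := reg K; exists n0.
  by move=> h K; have [n0 _ h0] := h K Logic.I; exists n0.
apply: bigcap_measurable; first by exists 0%N.
move=> K _; apply: bigcup_measurable => n0 _; apply: bigcap_measurable;
  first by exists n0 => /=.
move=> n _.
pose I : finType := {ffun 'I_N -> 'I_(2 * K * 2 ^ n).+1}.
pose F (e : (I * I)%type) : set Omega :=
  if `[< row_close n (@grid_point R N K n e.1) (grid_point e.2) >]
  then [set w | eta n < `|X (grid_point e.1) w - X (grid_point e.2) w|] else set0.
rewrite (_ : [set w | _] = ~` [set w | exists e, F e w]).
  apply: measurableC; apply: measurable_fin_exists => e; rewrite /F.
  case: ifP => // _; apply: measurable_gt_cst; apply: measurableT_comp => //.
  exact: measurable_funB.
apply/seteqP; split => w /=.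
  move=> h [[k l]]; rewrite /F /=; case: asboolP => // kl /=.
  by rewrite ltNge h.
move=> h k l kl; rewrite leNgt; apply/negP => hlt; apply: h; exists (k, l).
by rewrite /F /=; case: asboolP.
Qed.

Lemma continuous_version_exists :
  exists Xt : 'rV[R]_N -> {RV P >-> R}, version X Xt /\ continuous_paths Xt.
Proof.
have [B B0 [reg ptw]] := ae_grid_regular ltr01.
pose eta := level_bound alpha H 1 B.
have eta0 n : 0 <= eta n by exact: level_bound_ge0.
have [rho [n1 [rho0 rho1 eta_rho]]] := level_bound_ratio alpha_gt0 H_gt0 ltr01 B0.
pose G := [set w | grid_regular eta (fun t => X t w)].
have mG : measurable G by exact: measurable_grid_regular.
(* Zero off the measurable full event [G], so that every path is continuous; measurability follows
   from the limit of [X (row_dyadic_floor n t) * \1_G]. *)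
pose xt t (w : Omega) : R := if pselect (G w) then dyadic_limit (fun t =>
  X t w) t else 0.
have mxt t : measurable_fun setT (xt t).
  apply: (@measurable_fun_cvg _ _ _ _ (fun n w =>
    X (row_dyadic_floor n t) w * \1_G w)).
    by move=> n; apply: measurable_funM => //; exact: measurable_indic.
  move=> w _; rewrite /xt; case: pselect => [Gw|Gw].
    rewrite indicE mem_set// mulr1n; under eq_fun do rewrite mulr1.
    exact: (dyadic_limit_cvg eta0 rho0 rho1 eta_rho Gw).
  by rewrite indicE memNset//; under eq_fun do rewrite mulr0; exact: cvg_cst.
have xtP t : xt t \in @mfun _ _ Omega R by rewrite inE; exact: mxt.
exists (fun t => mfun_Sub (xtP t)); split.
  move=> t; apply/ae_probability1; first exact: measurable_RV_eq.
  apply: filterS2 reg (ptw t) => w Gw hw /=.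
  rewrite -[LHS]/(xt t w) /xt; case: pselect => // Gw'.
  have c : X (row_dyadic_floor n t) w @[n --> \oo] -->
      dyadic_limit (fun t => X t w) t.
    exact: (dyadic_limit_cvg eta0 rho0 rho1 eta_rho Gw).
  apply: (cvg_unique _ c); first exact: norm_hausdorff.
  apply/cvgrPdist_le => e e0.
  have /cvgrPdist_le/(_ _ e0) := ratio_cvg0 eta0 rho0 rho1 eta_rho.
  apply: filterS2 hw => n h1; rewrite sub0r normrN ger0_norm// => h2.
  exact: le_trans h1 h2.
move=> w.
rewrite -[fun t => _]/(fun t => xt t w).
rewrite /xt; case: pselect => [Gw|Gw]; last exact: cst_continuous.
exact: (dyadic_limit_continuous eta0 rho0 rho1 eta_rho Gw).
Qed.

Lemma version_grid_regular (Xt : 'rV[R]_N -> {RV P >-> R}) (eta : nat -> R) :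
  version X Xt -> {ae P, forall w, grid_regular eta (fun t => X t w)} ->
  {ae P, forall w, grid_regular eta (fun t => Xt t w)}.
Proof.
move=> vX.
have eqX : {ae P, forall w, forall K n (k : {ffun 'I_N -> 'I_(2 * K * 2 ^ n).+1}),
    Xt (grid_point k) w = X (grid_point k) w}.
  apply: ae_foralln => K; apply: ae_foralln => n.
  apply: filter_forall => k; apply/ae_probability1; last exact: vX.
  exact: measurable_RV_eq.
apply: filterS2 eqX => w e reg K; have := reg K; apply: filterS => n h k l kl.
by rewrite !e; exact: h.
Qed.

End harmonizable_field_bounds.

(** * From dyadic levels to the limsup of the modulus *)

Section modulus_limsup.
Context {R : realType} {N : nat}.
Variables (alpha H delta B c gamma : R) (x : 'rV[R]_N -> R).
Hypotheses (alpha_gt0 : 0 < alpha) (H_gt0 : 0 < H) (delta_gt0 : 0 < delta)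
  (B_gt0 : 0 < B) (c_gt0 : 0 < c).
Hypothesis gamma_gt : (1 + delta) * (2 / alpha) < gamma.
Hypothesis x_modulus : exists n0, forall n s t, (n0 <= n)%N ->
  row_cube 1 s -> row_cube 1 t -> row_close n s t ->
  `|x s - x t| <= c * level_bound alpha H delta B n.

Lemma modulus_le (h : R) n : (forall s t, row_cube 1 s -> row_cube 1 t ->
    row_close n s t -> `|x s - x t| <= c * level_bound alpha H delta B n) ->
  h <= (2 ^+ n)^-1 -> (modulus x h <= (c * level_bound alpha H delta B n)%:E)%E.
Proof.
move=> hx hn; apply: ge_ereal_sup => _ [[s t] /= [s1 t1 st]] <-.
rewrite lee_fin distrC.
have cube1 (u : 'rV[R]_N) : unit_cube u -> row_cube 1 u.
  by move=> u1 i; have /andP[u0 ui] := u1 i; rewrite ger0_norm.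
apply: hx; [exact: cube1|exact: cube1|].
move=> i; apply: le_trans hn; apply: le_trans st.
by have := coord_le_enorm (s - t) i; rewrite !mxE.
Qed.

Lemma modulus_ge0 (h : R) : 0 <= h -> (0 <= modulus x h)%E.
Proof.
move=> h0; apply: ereal_sup_ubound; exists (0, 0); last by rewrite /= subrr normr0.
split => /=; try by move=> i; rewrite mxE lexx ler01.
rewrite subrr /enorm /inner big1 ?sqrtr0// => i _.
by rewrite mxE mul0r.
Qed.

(** For [h] between [2^-(n+1)] and [2^-n] the quotient is at most [A0 (n+1)^(- th)], where [th] is
    the strict gap between [gamma] and the exponent of the level bound. *)
Lemma level_bound_div_log_le (e : R) : 0 < e -> exists n0 : nat, forall n h,
  (n0 <= n)%N ->
  0 < h -> 2 ^+ n <= 1 / h -> 1 / h < 2 ^+ n.+1 ->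
  c * level_bound alpha H delta B n / (h `^ H * ln (1 / h) `^ gamma) <= e.
Proof.
move=> e0; pose ga := (1 + delta) * (2 / alpha).
have ga0 : 0 < ga by rewrite mulr_gt0 ?divr_gt0// addr_gt0.
have gamma0 : 0 < gamma by exact: lt_trans gamma_gt.
pose th := gamma - ga; have th0 : 0 < th by rewrite subr_gt0.
(* For [n >= 1] one has [ln (1 / h) >= n ln 2 >= (n + 1) kappa]; this is why the threshold is at
   least 1. *)
pose kappa : R := ln 2 / 2.
have kappa0 : 0 < kappa by rewrite divr_gt0// ln_gt0// ltr1n.
pose h2 : R := 2 `^ (- H).
have h20 : 0 < h2 by exact: powR_gt0.
have kg0 : 0 < kappa `^ gamma by exact: powR_gt0.
pose A0 := c * B / (h2 * kappa `^ gamma).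
have A00 : 0 < A0 by rewrite divr_gt0 ?mulr_gt0.
(* The value of [n + 1] beyond which [A0 <= e (n+1)^th]. *)
pose Q := (A0 / e) `^ th^-1.
have Q0 : 0 <= Q by exact: powR_ge0.
exists (maxn 1 (Num.bound Q)) => n h; rewrite geq_max => /andP[n1 nQ] h0 hn1 hn2.
have p0 k : 0 < 2 ^+ k :> R by rewrite exprn_gt0.
set m : R := n.+1%:R.
have m0 : 0 < m by rewrite ltr0n.
have Qm : Q <= m.
  by apply: (le_trans (ltW (archi_boundP Q0))); rewrite ler_nat leqW.
have Am : A0 <= e * m `^ th.
  rewrite mulrC -ler_pdivrMr//.
  have -> : A0 / e = Q `^ th.
    by rewrite /Q -powRrM mulVf ?gt_eqF// powRr1// ltW// divr_gt0.
  by apply: powR_le => //; exact: ltW.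
have hH : h2 * (2 ^+ n) `^ (- H) <= h `^ H.
  have -> : h2 * (2 ^+ n) `^ (- H) = ((2 ^+ n.+1)^-1) `^ H.
    have -> : (2 ^+ n.+1)^-1 = (2 ^+ n.+1) `^ (- 1) :> R by rewrite powR_inv1// ltW.
    by rewrite -powRrM mulN1r exprS powRM// ltW.
  apply: powR_le; [exact: ltW|by rewrite invr_ge0 ltW|].
  rewrite div1r in hn2; rewrite -[leRHS]invrK lef_pV2 ?posrE ?invr_gt0//.
  exact: ltW.
have hL : m * kappa <= ln (1 / h).
  apply: (@le_trans _ _ (ln (2 ^+ n))); last first.
    by rewrite ler_ln ?posrE// divr_gt0.
  rewrite lnXn// -[leRHS]mulr_natl /kappa.
  have n1' : 1 <= n%:R :> R by rewrite ler1n.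
  have l0 : 0 < ln 2 :> R by rewrite ln_gt0// ltr1n.
  rewrite /m -natr1; nra.
have hLg : m `^ gamma * kappa `^ gamma <= ln (1 / h) `^ gamma.
  rewrite -powRM ?(ltW m0) ?(ltW kappa0)//; apply: powR_le => //; first exact: ltW.
  by rewrite mulr_ge0// ltW.
have D0 : 0 < h2 * (2 ^+ n) `^ (- H) * (m `^ gamma * kappa `^ gamma).
  by rewrite !mulr_gt0 ?powR_gt0.
have DD : h2 * (2 ^+ n) `^ (- H) * (m `^ gamma * kappa `^ gamma) <=
    h `^ H * ln (1 / h) `^ gamma.
  by apply: ler_pM => //; rewrite mulr_ge0 ?powR_ge0// ltW.
rewrite ler_pdivrMr; last exact: lt_le_trans DD.
apply: (@le_trans _ _ (e * (h2 * (2 ^+ n) `^ (- H) * (m `^ gamma * kappa `^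
  gamma)))); last first.
  by rewrite ler_pM2l.
have -> : m `^ gamma = m `^ th * m `^ ga.
  by rewrite -powRD ?(gt_eqF m0) ?implybT// /th subrK.
rewrite /level_bound -/ga -/m.
have a0 : 0 < (2 ^+ n) `^ (- H) * m `^ ga :> R by rewrite mulr_gt0 ?powR_gt0.
have -> : c * (B * (2 ^+ n) `^ (- H) * m `^ ga) =
    A0 * ((h2 * kappa `^ gamma) * ((2 ^+ n) `^ (- H) * m `^ ga)).
  rewrite /A0 [RHS]mulrA divfK ?gt_eqF ?mulr_gt0//.
  set a := powR _ (- H); set b := powR m ga; ring.
have alg (a1 a2 a3 a4 a5 : R) : e * (a1 * a2 * (a3 * a4 * a5)) =
   (e * a3) * ((a1 * a5) * (a2 * a4)) by ring.
rewrite alg; apply: ler_wpM2r => //; apply: ltW.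
by apply: mulr_gt0 => //; exact: mulr_gt0.
Qed.

Lemma modulus_limsup_eq0 :
  limf_esup (fun h : R => modulus x h *
    ((h `^ H * ln (1 / h) `^ gamma)^-1)%:E)%E 0^'+ = 0%E.
Proof.
rewrite limf_esupE; apply/eqP; rewrite eq_le; apply/andP; split; last first.
  apply: le_ereal_inf_tmp => _ [V V0 <-].
  have [h [Vh h0]] : exists h : R, V h /\ 0 < h.
    have V0' : 0^'+ (V `&` [set h : R | 0 < h]).
      by apply: filterI => //; exact: nbhs_right_gt.
    by have [h [Vh h0]] := filter_ex V0'; exists h.
  apply: (@le_trans _ _ (modulus x h * ((h `^ H * ln (1 / h) `^ gamma)^-1)%:E)%E).
    by rewrite mule_ge0// ?modulus_ge0 ?(ltW h0)// lee_fin invr_ge0 mulr_ge0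
      ?powR_ge0.
  by apply: ereal_sup_ubound; exists h.
apply/lee_addgt0Pr => e e0; rewrite add0e.
have [n1 hn1] := x_modulus; have [n2 hn2] := level_bound_div_log_le e0.
pose n0 := maxn n1 n2.
have r0 : 0 < (2 ^+ n0)^-1 :> R by rewrite invr_gt0 exprn_gt0.
apply: (@le_trans _ _ (ereal_sup [set (modulus x h *
    ((h `^ H * ln (1 / h) `^ gamma)^-1)%:E)%E | h in
    [set h : R | 0 < h /\ h < (2 ^+ n0)^-1]])).
  apply: ereal_inf_lbound; exists [set h : R | 0 < h /\ h < (2 ^+ n0)^-1] => //.
  by apply: filterI; [exact: nbhs_right_gt|exact: nbhs_right_lt].
apply: ge_ereal_sup => _ [h /= [h0 hr] <-].
have h1 : 2 ^+ n0 < 1 / h.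
  by rewrite div1r -[ltLHS]invrK ltf_pV2 ?posrE.
have h1' : 1 <= 1 / h by apply: le_trans (ltW h1); rewrite exprn_ege1// ler1n.
have [n /andP[nh hn]] := powR2_itv h1'.
have n0n : (n0 <= n)%N.
  by have := lt_trans h1 hn; rewrite ltr_eXn2l ?ltr1n.
move: (n0n); rewrite geq_max => /andP[n1n n2n].
have hh : h <= (2 ^+ n)^-1.
  by rewrite -[leLHS]invrK lef_pV2 ?posrE ?invr_gt0 ?exprn_gt0// -div1r.
apply: (@le_trans _ _ ((c * level_bound alpha H delta B n)%:E *
   ((h `^ H * ln (1 / h) `^ gamma)^-1)%:E)%E).
  apply: lee_wpmul2r; first by rewrite lee_fin invr_ge0 mulr_ge0 ?powR_ge0.
  by apply: modulus_le => // s t; exact: hn1.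
by rewrite -EFinM lee_fin; exact: (hn2 n h n2n h0 nh hn).
Qed.

End modulus_limsup.

Theorem theorem4p5 (R : realType) (d : measure_display)
    (Omega : measurableType d) (P : probability Omega R) (N : nat)
    (alpha H K11 K12 : R) (Delta : {measure set 'rV[R]_N -> \bar R})
    (f : 'rV[R]_N -> R) (M : set 'rV[R]_N -> Omega -> R[i])
    (X : 'rV[R]_N -> {RV P >-> R}) :
  (0 < N)%N ->
  0 < alpha -> alpha < 2 -> 0 < H -> H < 1 -> 0 < K11 -> 0 < K12 ->
  rot_inv_stable_random_measure P alpha Delta M ->
  (\int[Delta]_x (Num.min 1 (enorm x `^ alpha))%:E < +oo)%E ->
  measurable_fun setT f -> (forall x, 0 <= f x) ->
  (forall A, measurable A ->
    Delta A = (\int[lebesgue_row N]_(x in A) (f x)%:E)%E) ->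
  (forall x, K12 <= enorm x ->
    f x <= K11 * enorm x `^ (- (alpha * H + N%:R))) ->
  harmonizable_field alpha Delta M X ->
  (exists Xt : 'rV[R]_N -> {RV P >-> R}, version X Xt /\ continuous_paths Xt) /\
  (forall Xt : 'rV[R]_N -> {RV P >-> R}, version X Xt -> continuous_paths Xt ->
    forall eps : R, 0 < eps ->
    {ae P, forall w,
      limf_esup (fun h : R =>
        modulus (fun t => Xt t w) h *
        ((h `^ H * ln (1 / h) `^ ((2 + eps) / alpha))^-1)%:E)%E 0^'+ = 0%E}).
Proof.
move=> N_gt0 alpha_gt0 alpha_lt2 H_gt0 H_lt1 K11_gt0 K12_gt0 rsmM Delta_int mf f_ge0
  DeltaE f_le hX.
split.
  exact: (continuous_version_exists N_gt0 alpha_gt0 alpha_lt2 H_gt0 H_lt1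
    K11_gt0 K12_gt0 rsmM Delta_int mf f_ge0 DeltaE f_le hX).
(* Then [(1 + delta) * 2 = 2 + eps / 2 < 2 + eps], the strict gap that makes the limit 0 and not
   merely finite. *)
move=> Xt vX cX eps eps0; pose delta := eps / 4.
have d0 : 0 < delta by rewrite divr_gt0.
have [B B0 [reg _]] := ae_grid_regular N_gt0 alpha_gt0 alpha_lt2 H_gt0 H_lt1
  K11_gt0 K12_gt0 rsmM Delta_int mf f_ge0 DeltaE f_le hX d0.
have eta0 n : 0 <= level_bound alpha H delta B n by exact: level_bound_ge0.
have [rho [n1 [rho0 rho1 eta_rho]]] := level_bound_ratio alpha_gt0 H_gt0 d0 B0.
have := version_grid_regular vX reg.
apply: filterS => w regw.
apply: (@modulus_limsup_eq0 _ _ alpha H delta B (2 * (1 - rho)^-1 + 1)) => //.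
- by rewrite ltr_wpDl// mulr_ge0// invr_ge0 subr_ge0 ltW.
- rewrite mulrA ltr_pM2r ?invr_gt0// /delta; lra.
(* The cube [[-1, 1]^N] contains the unit cube. By continuity the path [Xt] coincides with its own
   dyadic limit, which extends the grid estimate to all its points. *)
have [n0 hn0] := dyadic_limit_modulus eta0 rho0 rho1 eta_rho regw 1.
exists n0 => n s t n0n s1 t1 st; have := hn0 n s t n0n s1 t1 st.
by rewrite !dyadic_limit_id//; exact: cX.
Qed.
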